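(* Let $n\ge3$, $\tilde g$ a smooth Riemannian metric on $N^n$, $M^2$ a Riemann surface, $f:M^2\to N^n$ a $C^\infty$-branched conformal immersion, $p\in M^2$ a branch point of order $s$, and $(U,x)$, $(V,y)$ $C^\infty$-branch coordinates at $p$. If $y$ is a conformal diffeomorphism, $\iota$ is the index of $p$ and $\varrho$ is the distinguished degree of $p$ (with respect to $(U,x)$, $(V,y)$), then $\varrho\ge2(\iota-s)$. In particular, the distinguished coefficient of $\hat f=y\circ f\circ x^{-1}$ is a $C^{2(\iota-s)-1,1}_{loc}$-map.
   Context: Conventions. $\mathbb N=\{1,2,\dots\}$; $C^{k,1}_{loc}$: $k$ times continuously differentiable with locally Lipschitz $k$-th derivatives ($C^\infty$ if $k=\infty$; if $\iota=\infty$ then $2(\iota-s)=\infty$ and $2(\iota-s)-1=\infty$). $\mathbb R^2=\mathbb C$ via $z=x_1+ix_2$; $\frac{\partial}{\partial z}=\frac12(\frac{\partial}{\partial x_1}-i\frac{\partial}{\partial x_2})$, $\frac{\partial}{\partial\bar z}=\frac12(\frac{\partial}{\partial x_1}+i\frac{\partial}{\partial x_2})$. For coordinate systems $(U,x)$ at $p$ and $(V,y)$ at $f(p)$, $f(U)\subset V$ is assumed. Branch points. $p$ is a branch point of order $s\in\mathbb N$ of a $C^1$-map $f$ if there are coordinate systems at $p$, $f(p)$ with $x(p)=0$, $y(f(p))=0$ such that $\sigma(z):=\hat f_1(z)+i\hat f_2(z)-z^{s+1}=o(|z|^{s+1})$, $\hat f_k(z)=o(|z|^{s+1})$ for $3\le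 k\le n$, and $\frac{\partial\sigma}{\partial x_j}(z),\frac{\partial\hat f_k}{\partial x_j}(z)=o(|z|^s)$ for $3\le k\le n$, $j=1,2$. A branched immersion is a $C^1$-map regular except at branch points. It is conformal if in every (complex) chart of the Riemann surface $M^2$, $\tilde g(f_*\frac{\partial}{\partial x_1},f_*\frac{\partial}{\partial x_1})=\tilde g(f_*\frac{\partial}{\partial x_2},f_*\frac{\partial}{\partial x_2})$ and $\tilde g(f_*\frac{\partial}{\partial x_1},f_*\frac{\partial}{\partial x_2})=0$; coordinate systems $(U,x)$ on $M^2$ are complex charts. $C^\infty$-branch coordinates at $p$: coordinate systems $(U,x)$, $(V,y)$ at $p$, $f(p)$ with $x(p)=0$, $y(f(p))=0$ such that, for $s$ the order of $p$, there is a smooth map $d:x(U)\to\mathbb C^n$ with: (a) $\frac{\partial\hat f}{\partial z}(z)=(s+1)z^sd(z)$ on $x(U)$; (b) $d_1=\frac12(1+d_1')$, $d_2=-\frac i2(1+d_2')$, $d_1'(0)=d_2'(0)=0$, $d_j(0)=0$ for $3\le j\le n$; (c) $\det\begin{pmatrix}2\mathrm{Re}\,d_1&-2\mathrm{Im}\,d_1\\2\mathrm{Re}\,d_2&-2\mathrm{Im}\,d_2\end{pmatrix}\neq0$ on $x(U)$; (d) $1+\frac12(d_1'+d_2')\ne0$ on $x(U)$ and $\sup_{x(U)}\dfrac{|\frac12(d_1'-d_2')|}{|1+\frac12(d_1'+d_2')|}<1$. Index, distinguished degree. For a smooth map $G$ near $0\in\mathbb C$ with values in $\mathbb C^k$ and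 $G(0)=0$, $ord_z(G)\in\mathbb N\cup\{\infty\}$ is the least $j\in\mathbb N$ with $\frac{\partial^jG}{\partial z^j}(0)\ne0$ ($\infty$ if there is none). The index is $\iota=ord_z(\hat f_3,\dots,\hat f_n)-1$ and the distinguished degree is $\varrho=ord_z(\overline a)-(s+1)$, where $a=\hat f_1+i\hat f_2$. Distinguished coefficient. The continuous function $\varpi:x(U)\to\mathbb C$ with $\varpi(0)=0$ and $\varpi(z)=\dfrac{\bar z^s\,\frac12\overline{(d_1'(z)-d_2'(z))}}{z^s(1+\frac12(d_1'(z)+d_2'(z)))}$ for $z\ne0$. $y:V\to y(V)\subset\mathbb R^n$ is a conformal diffeomorphism if the pullback by $y$ of the Euclidean metric equals $\rho\,\tilde g$ for a positive function $\rho$ on $V$. *)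

(* Defs.v *)
From HB Require Import structures.
From mathcomp Require Import all_boot all_order all_algebra.
From mathcomp Require Import all_classical all_reals all_analysis.
From mathcomp Require Import complex.

Set Implicit Arguments.
Unset Strict Implicit.
Unset Printing Implicit Defensive.

Import Order.TTheory GRing.Theory Num.Theory.
Import numFieldNormedType.Exports.

Local Open Scope classical_set_scope.
Local Open Scope complex_scope.
Local Open Scope ring_scope.

(* Points of R^m are row vectors, so that the Jacobian matrix 'J h a has the
   partial derivative of h in direction i as its i-th row. The topology of
   'rV[R]_m is the one of the sup norm, i.e. the Euclidean topology. *)

Section Differentiability.
Variables (R : realType) (m : nat) (W : normedModType R).
Implicit Types (A : set 'rV[R]_m) (h : 'rV[R]_m -> W).

Definition pderiv (i : 'I_m) h : 'rV[R]_m -> W :=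
  fun a => 'D_(delta_mx 0 i) h a.

(* In the next definitions A is meant to be open; values outside A are
   irrelevant. *)
Definition continuous_at_all A h := forall a, A a -> {for a, continuous h}.

Definition locally_lipschitz A h :=
  forall a, A a -> exists2 B, nbhs a B & [lipschitz h z | z in B].

(* h is k times differentiable on A and all its partial derivatives of order k
   satisfy [base] *)
Fixpoint iter_differentiable (base : set 'rV[R]_m -> ('rV[R]_m -> W) -> Prop)
    (k : nat) A h : Prop :=
  if k is k'.+1 then
    (forall a, A a -> differentiable h a) /\
    (forall i, iter_differentiable base k' A (pderiv i h))
  else base A h.

Definition Ck := iter_differentiable continuous_at_all.
Definition Ck1loc := iter_differentiable locally_lipschitz.
Definition Csmooth A h := forall k, Ck k A h.

End Differentiability.

Section ComplexCalculus.
Variable R : realType.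
Implicit Types (A : set 'rV[R]_2) (G : 'rV[R]_2 -> R[i]).

(* the identification R^2 = C *)
Definition toC (v : 'rV[R]_2) : R[i] := v 0 0 +i* v 0 1.

Definition cmod (c : R[i]) : R := Normc.normc c.

Definition pderivC (j : 'I_2) G : 'rV[R]_2 -> R[i] := fun v =>
  pderiv j (fun w => complex.Re (G w)) v +i* pderiv j (fun w => complex.Im (G w)) v.

Definition dz G : 'rV[R]_2 -> R[i] := fun v =>
  2%:R^-1 * (pderivC 0 G v - 'i%C * pderivC 1 G v).
Definition dzbar G : 'rV[R]_2 -> R[i] := fun v =>
  2%:R^-1 * (pderivC 0 G v + 'i%C * pderivC 1 G v).

Definition dz_vec k (G : 'rV[R]_2 -> 'rV[R[i]]_k) : 'rV[R]_2 -> 'rV[R[i]]_k :=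
  fun v => \row_j dz (fun w => G w 0 j) v.

Definition CsmoothC A G :=
  Csmooth A (fun v => complex.Re (G v)) /\ Csmooth A (fun v => complex.Im (G v)).

(* C^{r,1}_loc for r in N u {oo}, where r = +oo means smooth; the other
   values of r are not regularity classes *)
Definition Ck1locC (r : \bar int) A G : Prop :=
  match r with
  | (Posz k)%:E => Ck1loc k A (fun v => complex.Re (G v)) /\
                   Ck1loc k A (fun v => complex.Im (G v))
  | +oo%E => CsmoothC A G
  | _ => False
  end.

Definition holomorphic A (h : 'rV[R]_2 -> 'rV[R]_2) :=
  forall a, A a -> differentiable h a /\ dzbar (toC \o h) a = 0.

(* the least j >= 1 such that the j-th z-derivative of G does not vanish
   at 0 *)
Definition ord_z k (G : 'rV[R]_2 -> 'rV[R[i]]_k) : \bar int :=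
  match pselect (exists j,
    (0 < j)%N && (iter j (@dz_vec k) G 0 != 0)) with
  | left h => ((ex_minn h)%:Z)%:E
  | right _ => +oo%E
  end.

End ComplexCalculus.

Section Manifolds.
Variable R : realType.

(* [cmap] and [cinv] are total functions, relevant only on [cdom] and
   [cmap @` cdom] respectively. *)
Record chart (T : topologicalType) (m : nat) := Chart {
  cdom : set T;
  cmap :> T -> 'rV[R]_m;
  cinv : 'rV[R]_m -> T;
  cdom_open : open cdom;
  cimg_open : open (cmap @` cdom);
  cmapK : forall q, cdom q -> cinv (cmap q) = q;
  cmap_continuous : forall q, cdom q -> {for q, continuous cmap};
  cinv_continuous : forall v, (cmap @` cdom) v -> {for v, continuous cinv} }.

Definition cimg T m (x : chart T m) : set 'rV[R]_m := x @` cdom x.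

Section Structures.
Variables (m : nat) (reg : set 'rV[R]_m -> ('rV[R]_m -> 'rV[R]_m) -> Prop).

Definition compatible T (x y : chart T m) :=
  reg (x @` (cdom x `&` cdom y)) (y \o cinv x) /\
  reg (y @` (cdom x `&` cdom y)) (x \o cinv y).

Record manifold := Manifold {
  mpoints :> topologicalType;
  atlas : set (chart mpoints m);
  mhausdorff : hausdorff_space mpoints;
  msecond_countable : @second_countable mpoints;
  atlas_cover : forall q, exists2 x, atlas x & cdom x q;
  atlas_compatible : forall x y, atlas x -> atlas y -> compatible x y;
  atlas_maximal : forall x,
    (forall y, atlas y -> compatible x y) -> atlas x }.

End Structures.

Definition smooth_manifold (n : nat) := manifold (@Csmooth R n 'rV[R]_n).
Definition riemann_surface := manifold (@holomorphic R).

(* The matrix at a of the pullback by h of a bilinear form with matrix B at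
   h a. *)
Definition pullback_mx m n (h : 'rV[R]_m -> 'rV[R]_n) (B : 'M[R]_n) a : 'M[R]_m :=
  'J h a *m B *m ('J h a)^T.

(* A (0,2)-tensor field is given by its component matrices [gmx y q] at q in
   each chart y around q. *)
Record riemannian_metric n (N : smooth_manifold n) := RiemannianMetric {
  gmx :> chart N n -> N -> 'M[R]_n;
  gmx_sym : forall y q, atlas y -> cdom y q -> (gmx y q)^T = gmx y q;
  gmx_pos : forall y q, atlas y -> cdom y q ->
    forall v : 'rV[R]_n, v != 0 -> 0 < (v *m gmx y q *m v^T) 0 0;
  gmx_smooth : forall y, atlas y ->
    forall i j, Csmooth (cimg y) (fun v => gmx y (cinv y v) i j);
  gmx_tensor : forall y w q, atlas y -> atlas w -> cdom y q -> cdom w q ->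
    gmx y q = pullback_mx (w \o cinv y) (gmx w q) (y q) }.

Definition conformal_diffeomorphism n (N : smooth_manifold n)
    (g : riemannian_metric N) (y : chart N n) :=
  exists rho : N -> R, forall q, cdom y q -> 0 < rho q /\
    forall w, atlas w -> cdom w q ->
      pullback_mx (y \o cinv w) 1%:M (w q) = rho q *: g w q.

End Manifolds.

Section BranchedImmersions.
Variables (R : realType) (n : nat).
Variables (N : smooth_manifold R n) (M : riemann_surface R) (f : M -> N).
Implicit Types (p q : M) (s : nat) (x : chart R M 2) (y : chart R N n).

Definition hat x y : 'rV[R]_2 -> 'rV[R]_n := y \o f \o cinv x.

(* component number k, counted from 0, of a vector of K^n *)
Definition cpt (K : nmodType) (v : 'rV[K]_n) (k : nat) : K :=
  if insub k is Some i then v 0 i else 0.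

Definition Cmap k := continuous f /\ forall x y, atlas x -> atlas y ->
  Ck k (x @` (cdom x `&` f @^-1` cdom y)) (hat x y).
Definition smooth_map := forall k, Cmap k.

Definition charts_at p x y :=
  [/\ atlas x, atlas y, cdom x p, cdom y (f p) & f @` cdom x `<=` cdom y].

Definition centered_charts_at p x y :=
  [/\ charts_at p x y, x p = 0 & y (f p) = 0].

Definition regular_point q :=
  exists x y, charts_at q x y /\ \rank ('J (hat x y) (x q)) = 2%N.

(* f^_1 + i f^_2 *)
Definition hatC x y : 'rV[R]_2 -> R[i] :=
  fun v => cpt (hat x y v) 0 +i* cpt (hat x y v) 1.

Definition is_branch_point p s :=
  (0 < s)%N /\
  exists x y, centered_charts_at p x y /\
  let sigma v := hatC x y v - toC v ^+ s.+1 in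
  let fk k v := cpt (hat x y v) k in
  [/\ (fun v => cmod (sigma v)) =o_ (0 : 'rV[R]_2)
        (fun v => cmod (toC v) ^+ s.+1),
      forall j, (fun v => cmod (pderivC j sigma v)) =o_ (0 : 'rV[R]_2)
        (fun v => cmod (toC v) ^+ s),
      forall k, (2 <= k < n)%N -> fk k =o_ (0 : 'rV[R]_2)
        (fun v => cmod (toC v) ^+ s.+1)
    & forall k j, (2 <= k < n)%N -> pderiv j (fk k) =o_ (0 : 'rV[R]_2)
        (fun v => cmod (toC v) ^+ s)].

Definition branched_immersion :=
  Cmap 1 /\ forall q, regular_point q \/ exists s, is_branch_point q s.

Definition conformal (g : riemannian_metric N) :=
  forall x y q, atlas x -> atlas y -> cdom x q -> cdom y (f q) ->
  let h := pullback_mx (hat x y) (g y (f q)) (x q) in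
  h 0 0 = h 1 1 /\ h 0 1 = 0.

(* [d] is the smooth map with df^/dz = (s+1) z^s d, and [d1'], [d2'] are the
   functions by which its first two components are expressed. They are
   determined by x, y and s on x(U). *)
Record branch_coordinates p s x y
    (d : 'rV[R]_2 -> 'rV[R[i]]_n) (d1' d2' : 'rV[R]_2 -> R[i]) : Prop := {
  bc_charts : centered_charts_at p x y;
  bc_smooth : forall k, CsmoothC (cimg x) (fun z => d z 0 k);
  bc_dz : forall z, cimg x z ->
    dz_vec (fun w => map_mx (real_complex R) (hat x y w)) z =
    (s.+1%:R * toC z ^+ s) *: d z;
  bc_d1 : forall z, cimg x z -> cpt (d z) 0 = 2%:R^-1 * (1 + d1' z);
  bc_d2 : forall z, cimg x z -> cpt (d z) 1 = - ('i%C / 2%:R) * (1 + d2' z);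
  bc_d1'0 : d1' 0 = 0;
  bc_d2'0 : d2' 0 = 0;
  bc_dk0 : forall k, (2 <= k < n)%N -> cpt (d 0) k = 0;
  bc_det : forall z, cimg x z ->
    \det (\matrix_(i < 2, j < 2)
      let di := cpt (d z) i in
      if j == 0 then 2%:R * complex.Re di else - (2%:R * complex.Im di)) != 0;
  bc_den : forall z, cimg x z -> 1 + 2%:R^-1 * (d1' z + d2' z) != 0;
  bc_sup : (ereal_sup [set (cmod (2%:R^-1 * (d1' z - d2' z)) /
      cmod (1 + 2%:R^-1 * (d1' z + d2' z)))%:E | z in cimg x] < 1)%E }.

(* ord_z(f^_3, ..., f^_n) - 1 *)
Definition branch_index x y : \bar int :=
  (ord_z (fun v => \row_(k < n - 2) (cpt (hat x y v) k.+2)%:C) - 1)%E.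

Definition distinguished_degree s x y : \bar int :=
  (ord_z (fun v => \row_(k < 1) conjc (hatC x y v)) - (s.+1%:Z)%:E)%E.

End BranchedImmersions.

Definition distinguished_coefficient (R : realType) (s : nat)
    (d1' d2' : 'rV[R]_2 -> R[i]) : 'rV[R]_2 -> R[i] := fun z =>
  if z == 0 then 0 else
  (conjc (toC z) ^+ s * (2%:R^-1 * conjc (d1' z - d2' z))) /
  (toC z ^+ s * (1 + 2%:R^-1 * (d1' z + d2' z))).

(* Main.v *)
(** The map is conformal with respect to the Euclidean metric of the target
    coordinates, so the squares of the components of d add up to 0. With
    E = d_1 - i d_2 = (d_1' - d_2')/2 and D = d_1 + i d_2 = 1 + (d_1' + d_2')/2
    this reads E D = - sum_{k >= 3} d_k^2.
    Each component of the map is real, hence its mixed derivatives at 0 are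
    divisible by both z^s and zbar^s; together with the vanishing of the pure
    z-derivatives up to the index iota this makes d_k (k >= 3) a smooth multiple
    of zbar^s plus a remainder vanishing to order q = iota - s. Squaring,
    E = zbar^s X + Y with X smooth and Y smooth vanishing to order 2q.
    The z-derivative of conj(a) is (s+1) z^s E, so its pure z-derivatives of
    order less than s + 2q vanish at 0, which is the bound on rho. The
    distinguished coefficient is (zbar^s / z^s) conj(E) / D, the sum of the
    smooth function zbar^s conj(X) / D and of (zbar/z)^s conj(Y) / D. Functions
    zbar^a / z^b h, with h smooth and vanishing to order M, are
    C^{a+M-b-1,1} because their partial derivatives have the same form. *)

Require Import Defs.
From mathcomp Require Import all_boot all_order all_algebra.
From mathcomp Require Import all_classical all_reals all_analysis.
From mathcomp Require Import complex ring lra zify.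

Set Implicit Arguments.
Unset Strict Implicit.
Unset Printing Implicit Defensive.

Import Order.TTheory GRing.Theory Num.Theory.
Import numFieldNormedType.Exports.

Local Open Scope classical_set_scope.
Local Open Scope complex_scope.
Local Open Scope ring_scope.

(** * Functions of class C^k *)

(** [f] is only smooth, so no convergent power series is at hand: division by [zbar^s] is carried
    out on jets of finite order, and an index [+oo] means that the argument with cut-off [q] applies
    for every [q]. The obstacle to regularity is the factor [(zbar/z)^s], bounded but discontinuous
    at 0. Conjugating [E = zbar^s X + Y] turns [zbar^s] into [z^s], which cancels the denominator
    for an arbitrary smooth [X]; only [Y] stays under the singular factor. The divisibility of the
    mixed jets comes from conjugating [df_k/dz = (s+1) z^s d_k] into
    [df_k/dzbar = (s+1) zbar^s conj(d_k)]: a mixed jet of [f_k] can be computed from either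
    equation. The shifts match exactly: [z^s E] has pure z-jets only from degree [s + 2q] on, hence
    [conj(a)] has pure z-jets of positive degree only from [s + 2q + 1] on, and the distinguished
    degree subtracts [s + 1]. *)

Section Differentiable.
Variables (R : realType) (V W : normedModType R).
Implicit Types (f g : V -> W) (a : V).

(** Differentiability is formulated through the chosen differential ['d f a], so a candidate [df]
    has to be identified with it by uniqueness before the expansion can be used. *)
Lemma differentiable_intro f a (df : {linear V -> W}) : continuous df ->
  (forall e, 0 < e -> \forall h \near 0, `|f (h + a) - f a - df h| <= e * `|h|) ->
  differentiable f a /\ 'd f a = df :> (V -> W).
Proof.
move=> dfc fo.
have fE : f \o shift a = cst (f a) + df +o_ 0 id.
  apply/eqaddoP => e e0.
  apply: filterS (fo e e0) => h /=.
  by rewrite -![(_ - _) h]/(_ - _) -[(_ + _) h]/(_ + _) /= opprD addrA.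
have E : 'd f a = df :> (V -> W) by exact: diff_unique.
by split=> //; apply/diff_locallyP; rewrite E.
Qed.

Lemma near_eq_differentiable f g a :
  (\near a, f a = g a) -> differentiable f a -> differentiable g a.
Proof.
move=> fg df.
have fga := nbhs_singleton fg.
apply: (@proj1 _ ('d g a = 'd f a :> (V -> W))); apply: differentiable_intro => [|e e0].
  exact: diff_continuous.
have /eqaddoP /(_ e e0) := diff_locally df.
have : \forall h \near (0 : V), f (h + a) = g (h + a).
  by move: fg; rewrite (near_shift 0 a) /=; apply: filterS => h /=; rewrite subr0.
apply: filterS2 => h E.
rewrite -![(_ - _) h]/(_ - _) -[(_ + _) h]/(_ + _) /= opprD addrA.
by rewrite E fga.
Qed.

End Differentiable.

Section IterDifferentiable.
Variables (R : realType) (m : nat) (W : normedModType R).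
Implicit Types (A : set 'rV[R]_m) (h g : 'rV[R]_m -> W).

Lemma eq_pderiv A h g i : open A -> (forall a, A a -> h a = g a) ->
  forall a, A a -> pderiv i h a = pderiv i g a.
Proof.
move=> oA hg a Aa; apply: near_eq_derive.
by apply: filterS (open_nbhs_nbhs (conj oA Aa)) => b /hg.
Qed.

Variable base : set 'rV[R]_m -> ('rV[R]_m -> W) -> Prop.
Hypothesis eq_base : forall A h g, open A -> (forall a, A a -> h a = g a) ->
  base A h -> base A g.

(** The formulas for derivatives of sums, products and inverses hold only on [A], so each step down
    in the recursion replaces a function by one that agrees with it on [A] alone. [base] stays a
    parameter to serve both [Ck] and [Ck1loc]. *)
Lemma eq_iter_differentiable k A h g : open A -> (forall a, A a -> h a = g a) ->
  iter_differentiable base k A h -> iter_differentiable base k A g.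
Proof.
move=> oA; elim: k h g => [|k IH] h g hg /=; first exact: eq_base.
move=> [dh ih]; split=> [a Aa|i].
  apply: near_eq_differentiable (dh a Aa).
  by apply: filterS (open_nbhs_nbhs (conj oA Aa)) => b /hg.
by apply: IH (ih i); apply: eq_pderiv.
Qed.

End IterDifferentiable.

Lemma eq_continuous_at_all (R : realType) m (W : normedModType R)
  (A : set 'rV[R]_m) (h g : 'rV[R]_m -> W) :
  open A -> (forall a, A a -> h a = g a) ->
  continuous_at_all A h -> continuous_at_all A g.
Proof.
move=> oA hg ch a Aa; have := ch a Aa.
rewrite /prop_for /continuous_at -(hg a Aa) => cha.
have hg' : {near nbhs a, h =1 g} by apply: filterS (open_nbhs_nbhs (conj oA Aa)) => b /hg.
exact: cvg_trans (near_eq_cvg hg') cha.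
Qed.

Lemma eq_Ck (R : realType) m (W : normedModType R) k
  (A : set 'rV[R]_m) (h g : 'rV[R]_m -> W) :
  open A -> (forall a, A a -> h a = g a) -> Ck k A h -> Ck k A g.
Proof. by apply: eq_iter_differentiable; apply: eq_continuous_at_all. Qed.

(** * Calculus of real-valued functions of class C^k *)

Section RealCalculus.
Variables (R : realType) (m : nat).
Implicit Types (A : set 'rV[R]_m) (f g : 'rV[R]_m -> R).

Lemma pderivE f a i : differentiable f a -> pderiv i f a = 'd f a (delta_mx 0 i).
Proof. exact: deriveE. Qed.

Lemma diff_pderiv f a v : differentiable f a ->
  'd f a v = \sum_i v 0 i * pderiv i f a.
Proof.
move=> df; rewrite {1}(row_sum_delta v) linear_sum; apply: eq_bigr => i _.
by rewrite linearZ pderivE.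
Qed.

Lemma pderiv_cst (c : R) (a : 'rV[R]_m) i : pderiv i (fun=> c) a = 0.
Proof. exact: derive_cst. Qed.

Lemma pderivD f g a i : differentiable f a -> differentiable g a ->
  pderiv i (fun v => f v + g v) a = pderiv i f a + pderiv i g a.
Proof. by move=> df dg; rewrite /pderiv (deriveD (f := f)) //; exact: diff_derivable. Qed.

Lemma pderivN f a i : differentiable f a ->
  pderiv i (fun v => - f v) a = - pderiv i f a.
Proof. by move=> df; rewrite /pderiv (deriveN (f := f)) //; exact: diff_derivable. Qed.

Lemma pderivM f g a i : differentiable f a -> differentiable g a ->
  pderiv i (fun v => f v * g v) a = pderiv i f a * g a + f a * pderiv i g a.
Proof.
move=> df dg; rewrite /pderiv (deriveM (f := f) (g := g)); [|exact: diff_derivable..].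
by rewrite addrC mulrC.
Qed.

Lemma pderivV f a i : differentiable f a -> f a != 0 ->
  pderiv i (fun v => (f v)^-1) a = - (pderiv i f a * (f a)^-1 * (f a)^-1).
Proof.
move=> df f0; rewrite /pderiv (deriveV (f := f)) //; last exact: diff_derivable.
by rewrite expr2 invfM; change (- ((f a)^-1 * (f a)^-1) * 'D_(delta_mx 0 i) f a = - ('D_(delta_mx 0 i) f a / f a / f a)); ring.
Qed.

Lemma Ck_differentiable k A f a : Ck k.+1 A f -> A a -> differentiable f a.
Proof. by case=> df _ /df. Qed.

Lemma CkS k A f : Ck k.+1 A f -> Ck k A f.
Proof.
elim: k f => [|k IH] f.
  by move=> [df _] a /df /differentiable_continuous.
by case=> df pf; split=> // i; exact/IH/pf.
Qed.

Lemma Ck_le k l A f : (k <= l)%N -> Ck l A f -> Ck k A f.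
Proof.
move=> /subnK <-; elim: (l - k)%N => // j IH; rewrite addSn => /CkS; exact: IH.
Qed.

Lemma Ck_cst k A (c : R) : open A -> Ck k A (fun=> c : R).
Proof.
move=> oA; elim: k c => [|k IH] c; first by move=> a _; exact: (@cst_continuous _ _ c).
split=> [a _|i]; first exact: differentiable_cst.
by apply: eq_Ck (IH 0) => // a _; rewrite pderiv_cst.
Qed.

Lemma CkD k A f g : open A -> Ck k A f -> Ck k A g -> Ck k A (fun v => f v + g v).
Proof.
move=> oA; elim: k f g => [|k IH] f g.
  by move=> cf cg a Aa; exact: (continuousD (cf a Aa) (cg a Aa)).
move=> [df pf] [dg pg]; split=> [a Aa|i].
  exact: (differentiableD (df a Aa) (dg a Aa)).
apply: eq_Ck (IH _ _ (pf i) (pg i)) => // a Aa.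
by rewrite pderivD //; [exact: df|exact: dg].
Qed.

Lemma CkN k A f : open A -> Ck k A f -> Ck k A (fun v => - f v).
Proof.
move=> oA; elim: k f => [|k IH] f.
  by move=> cf a Aa; exact: (continuousN (cf a Aa)).
move=> [df pf]; split=> [a Aa|i].
  exact: (differentiableN (df a Aa)).
apply: eq_Ck (IH _ (pf i)) => // a Aa.
by rewrite pderivN //; exact: df.
Qed.

Lemma CkM k A f g : open A -> Ck k A f -> Ck k A g -> Ck k A (fun v => f v * g v).
Proof.
move=> oA; elim: k f g => [|k IH] f g.
  by move=> cf cg a Aa; exact: (continuousM (cf a Aa) (cg a Aa)).
move=> Cf Cg; have [df pf] := Cf; have [dg pg] := Cg; split=> [a Aa|i].
  exact: (differentiableM (df a Aa) (dg a Aa)).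
apply: (@eq_Ck _ _ _ _ _ (fun v => pderiv i f v * g v + f v * pderiv i g v)) => //.
  by move=> a Aa; rewrite pderivM //; [exact: df|exact: dg].
exact: (CkD oA (IH _ _ (pf i) (CkS Cg)) (IH _ _ (CkS Cf) (pg i))).
Qed.

Lemma CkV k A f : open A -> (forall a, A a -> f a != 0) -> Ck k A f ->
  Ck k A (fun v => (f v)^-1).
Proof.
move=> oA f0; elim: k => [|k IH].
  by move=> cf a Aa; exact: (continuousV (f0 a Aa) (cf a Aa)).
move=> Cf; have [df pf] := Cf; split=> [a Aa|i].
  exact: (differentiableV (df a Aa) (f0 a Aa)).
apply: (@eq_Ck _ _ _ _ _ (fun v => - (pderiv i f v * (f v)^-1 * (f v)^-1))) => //.
  by move=> a Aa; rewrite pderivV //; [exact: df|exact: f0].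
(* The derivative contains the inverse itself, which is of class [C^k] by the induction
   hypothesis. *)
have CV := IH (CkS Cf).
exact: (CkN oA (CkM oA (CkM oA (pf i) CV) CV)).
Qed.

Lemma pderiv_coord (j i : 'I_m) a :
  pderiv i (fun v : 'rV[R]_m => v 0 j) a = (j == i)%:R.
Proof.
have dv : derivable (@id 'rV[R]_m) a (delta_mx 0 i) by exact: derivable_id.
have := derive_mx dv; rewrite derive_id => /(congr1 (fun M : 'rV[R]_m => M 0 j)).
by rewrite !mxE eqxx /= => ->.
Qed.

End RealCalculus.

(** * The mean value theorem and Lipschitz bounds *)

Section MeanValue.
Variables (R : realType) (m : nat).
Implicit Types (A : set 'rV[R]_m) (f g : 'rV[R]_m -> R) (a b v w : 'rV[R]_m).

Lemma normr_coord v i : `|v 0 i| <= `|v|.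
Proof.
rewrite [leRHS]/Num.Def.normr /= mx_normrE.
by apply: le_trans (le_bigmax _ _ (0, i)).
Qed.

Lemma norm_delta_mx_le1 i : `|delta_mx 0 i : 'rV[R]_m| <= 1.
Proof.
rewrite [leLHS]/Num.Def.normr /= mx_normrE bigmax_le // => -[j k] _ /=.
by rewrite mxE; case: (_ && _); rewrite ?normr1 ?normr0.
Qed.

Lemma mean_value f a v :
  (forall t : R, 0 <= t <= 1 -> differentiable f (a + t *: v)) ->
  exists2 t : R, 0 <= t <= 1 & f (a + v) - f a = 'd f (a + t *: v) v.
Proof.
move=> df; pose phi (t : R) := f (a + t *: v).
have dphi (t : R) : 0 <= t <= 1 -> is_diff t phi (fun s => 'd f (a + t *: v) (s *: v)).
  move=> t01; have dft := differentiableP (df t t01).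
  have dl : is_diff t (fun t : R => a + t *: v) (fun s => s *: v).
    rewrite (_ : (fun s => s *: v) = cst 0 + ( *:%R^~ v)); last by apply/funext => s /=; rewrite add0r.
    exact: is_diffD.
  exact: is_diff_comp.
have dphi1 (t : R) : 0 <= t <= 1 -> is_derive t 1 phi ('d f (a + t *: v) v).
  move=> /dphi dp; apply: DeriveDef; first by apply: diff_derivable; exact: ex_diff.
  by rewrite deriveE; [rewrite diff_val scale1r|exact: ex_diff].
have [| |t] := @MVT_segment _ phi (fun t => 'd f (a + t *: v) v) 0 1 ler01.
- by move=> x; rewrite in_itv /= => /andP[x0 x1]; apply: dphi1; rewrite !ltW.
- apply/continuous_in_subspaceT => x; rewrite inE /= in_itv /= => x01.
  by apply: differentiable_continuous; have dx := dphi x x01; exact: ex_diff.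
rewrite in_itv /= => t01 E; exists t => //.
by move: E; rewrite /phi scale1r scale0r addr0 subr0 mulr1.
Qed.

(** The factor [m] comes from the sup norm: each of the [m] summands of ['d f a v] is at most
    [C |v|]. *)
Lemma diff_le f a v C : differentiable f a ->
  (forall i, `|pderiv i f a| <= C) -> `|'d f a v| <= m%:R * C * `|v|.
Proof.
move=> df dC; rewrite diff_pderiv //.
apply: le_trans (ler_norm_sum _ _ _) _.
rewrite -mulrA mulr_natl -[X in _ *+ X]card_ord -sumr_const.
apply: ler_sum => i _; rewrite normrM mulrC.
by apply: ler_pM => //; exact: normr_coord.
Qed.

Lemma mean_value_le f a b C :
  (forall t : R, 0 <= t <= 1 -> differentiable f (a + t *: (b - a))) ->
  (forall (t : R) i, 0 <= t <= 1 -> `|pderiv i f (a + t *: (b - a))| <= C) ->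
  `|f b - f a| <= m%:R * C * `|b - a|.
Proof.
move=> df dC; have [t t01] := mean_value df.
rewrite subrKC => ->; apply: diff_le; first exact: df.
by move=> i; exact: dC.
Qed.

Lemma segment_ball a b c r t : 0 <= t <= 1 -> ball c r a -> ball c r b ->
  ball c r (a + t *: (b - a)).
Proof.
move=> /andP[t0 t1]; rewrite -!ball_normE /= => ca cb.
have -> : c - (a + t *: (b - a)) = (1 - t) *: (c - a) + t *: (c - b).
  by rewrite scalerBl scale1r !scalerBr; apply/matrixP => i j; rewrite !mxE; ring.
apply: le_lt_trans (ler_normD _ _) _; rewrite !normrZ ger0_norm ?subr_ge0 // ger0_norm //.
have [t1'|t1'] := ltP t 1; last first.
  have -> : t = 1 by lra.
  by rewrite subrr mul0r add0r mul1r.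
have : (1 - t) * `|c - a| < (1 - t) * r by rewrite ltr_pM2l // subr_gt0.
have : t * `|c - b| <= t * r by rewrite ler_wpM2l // ltW.
lra.
Qed.

Lemma lipschitz_bound (B : set 'rV[R]_m) f C c : B c ->
  (forall a b, B a -> B b -> `|f b - f a| <= C * `|b - a|) ->
  [lipschitz f z | z in B].
Proof.
move=> Bc fC; apply: (@klipschitzW _ _ _ C).
  exact: (@globally_properfilter _ _ (c, c)).
by move=> [a b] [/= Ba Bb]; exact: fC.
Qed.

(* The point 0 is allowed to be a singularity of the derivative: a segment
   through 0 is split there. *)
Lemma lipschitz_ball0 f C r : 0 < r -> 0 <= C ->
  (forall a, ball 0 r a -> a != 0 -> differentiable f a /\
     forall i, `|pderiv i f a| <= C) ->
  (forall a, ball 0 r a -> `|f a| <= C * `|a|) ->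
  [lipschitz f z | z in ball 0 r].
Proof.
move=> r0 C0 df fC.
apply: (@lipschitz_bound _ _ ((m%:R + 1) * C) 0); first exact: ballxx.
move=> a b Ba Bb.
have [[t t01 t0]|n0] := pselect (exists2 t : R, 0 <= t <= 1 & a + t *: (b - a) = 0).
  have /andP[t_ge0 t_le1] := t01.
  have Ea : a = - (t *: (b - a)) by apply/eqP; rewrite -addr_eq0 t0.
  have Eb : b = (1 - t) *: (b - a).
    by rewrite scalerBl scale1r -[X in _ = b - a - X]opprK -Ea opprK subrK.
  (* [a] and [b] lie on opposite sides of 0, so their norms add up and the bound on the values of
     [f] alone suffices. *)
  have nE : `|a| + `|b| = `|b - a|.
    have -> : `|a| = t * `|b - a| by rewrite {1}Ea normrN normrZ ger0_norm.
    have -> : `|b| = (1 - t) * `|b - a| by rewrite {1}Eb normrZ ger0_norm ?subr_ge0.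
    by ring.
  apply: le_trans (ler_normB _ _) _.
  apply: le_trans (lerD (fC b Bb) (fC a Ba)) _.
  rewrite -mulrDr [`|b| + _]addrC nE mulrDl mul1r mulrDl lerDr.
  by rewrite mulr_ge0 // mulr_ge0.
have dfs t : 0 <= t <= 1 -> ball 0 r (a + t *: (b - a)) /\ a + t *: (b - a) != 0.
  move=> t01; split; first exact: segment_ball.
  by apply/eqP => E; apply: n0; exists t.
apply: le_trans (@mean_value_le f a b C _ _) _.
- by move=> t /dfs[Bt Nt]; have [] := df _ Bt Nt.
- by move=> t i /dfs[Bt Nt]; have [_] := df _ Bt Nt.
- by rewrite ler_wpM2r // ler_wpM2r // lerDl.
Qed.

End MeanValue.

(** * Local bounds and the classes C^{k,1}_loc *)

Section SmoothFunctions.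
Variables (R : realType) (m : nat).
Implicit Types (A : set 'rV[R]_m) (f g : 'rV[R]_m -> R) (a b v w : 'rV[R]_m).

Lemma Ck_cpt n k A (h : 'rV[R]_m -> 'rV[R]_n) j : open A ->
  Ck k A h -> Ck k A (fun v => h v 0 j).
Proof.
move=> oA; elim: k h => [|k IH] h.
  move=> ch a Aa.
  exact: (@continuous_comp _ _ _ h (fun M : 'rV[R]_n => M 0 j) a (ch a Aa) (@coord_continuous _ _ _ _ _ _)).
move=> [dh ph]; split=> [a Aa|i].
  apply: (@differentiable_comp _ _ _ _ h (fun M : 'rV[R]_n => M 0 j)); first exact: dh.
  exact: differentiable_coord.
apply: eq_Ck (IH _ (ph i)) => // a Aa.
by rewrite /pderiv derive_mx; [rewrite mxE|apply: diff_derivable; exact: dh].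
Qed.

Lemma Ck_coord k A j : open A -> Ck k A (fun v => v 0 j).
Proof.
move=> oA; case: k => [|k]; first by move=> a _; exact: coord_continuous.
split=> [a _|i]; first exact: differentiable_coord.
by apply: eq_Ck (Ck_cst k (j == i)%:R oA) => // a _; rewrite pderiv_coord.
Qed.

Lemma continuous_ball_bound f a : {for a, continuous f} ->
  exists2 C, 0 <= C & exists2 r, 0 < r & forall b, ball a r b -> `|f b| <= C.
Proof.
move=> /cvgrPdist_lt /(_ 1 ltr01) /nbhs_ballP[r /= r0 fr].
exists (`|f a| + 1); first by rewrite addr_ge0.
exists r => // b /fr; rewrite distrC => fb.
rewrite -(subrK (f a) (f b)) addrC; apply: le_trans (ler_normD _ _) _.
by rewrite lerD2l ltW.
Qed.

Lemma pderiv_ball_bound A f a : open A -> A a -> Ck 1 A f ->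
  exists2 C, 0 <= C & exists2 r, 0 < r & forall b, ball a r b ->
    A b /\ forall i, `|pderiv i f b| <= C.
Proof.
move=> oA Aa [_ cf].
have [rA /= rA0 Ab] : exists2 r, 0 < r & ball a r `<=` A.
  by have /nbhs_ballP[r] := open_nbhs_nbhs (conj oA Aa); exists r.
(* Induction over the finite list of indices takes the maximum of the bounds and the minimum of the
   radii. *)
suff [C C0 [r r0 Cr]] : exists2 C, 0 <= C & exists2 r, 0 < r &
    forall b, ball a r b -> forall i, i \in enum 'I_m -> `|pderiv i f b| <= C.
  exists C => //; exists (Num.min rA r); first by rewrite lt_min rA0.
  move=> b Bb; split; first by apply/Ab/(le_ball _ Bb); rewrite ge_min lexx.
  by move=> i; apply: Cr; [apply/(le_ball _ Bb); rewrite ge_min lexx orbT|rewrite mem_enum].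
elim: (enum 'I_m) => [|i s [C C0 [r r0 IH]]]; first by exists 0 => //; exists 1.
have [C' C'0 [r' r'0 Ci]] := continuous_ball_bound (cf i a Aa).
exists (Num.max C C'); first by rewrite le_max C0.
exists (Num.min r r'); first by rewrite lt_min r0.
move=> b Bb j; rewrite in_cons => /orP[/eqP->|js].
  rewrite le_max (Ci b) ?orbT //.
  by apply: le_ball Bb; rewrite ge_min lexx orbT.
by rewrite le_max (IH b) //; apply: le_ball Bb; rewrite ge_min lexx.
Qed.

Lemma C1_locally_lipschitz A f : open A -> Ck 1 A f -> locally_lipschitz A f.
Proof.
move=> oA Cf a Aa; have [C C0 [r r0 fC]] := pderiv_ball_bound oA Aa Cf.
exists (ball a r); first exact: nbhsx_ballx.
apply: (@lipschitz_bound _ _ _ _ (m%:R * C) a); first exact: ballxx.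
move=> b c Bb Bc; apply: mean_value_le => t => [|i] t01; have /fC[At pC] := segment_ball t01 Bb Bc.
  exact: (Ck_differentiable Cf At).
exact: pC.
Qed.

Lemma Ck1_Ck1loc k A f : open A -> Ck k.+1 A f -> Ck1loc k A f.
Proof.
move=> oA; elim: k f => [|k IH] f; first exact: C1_locally_lipschitz.
by case=> df pf; split=> // i; exact/IH/pf.
Qed.

Lemma locally_lipschitz_continuous A f : locally_lipschitz A f -> continuous_at_all A f.
Proof.
move=> lf a /lf[B Ba] /pinfty_ex_gt0[C C0 fC].
apply/(@cvgrPdist_le _ _ _ (nbhs a)) => e e0.
have eC : 0 < e / C by rewrite divr_gt0.
have aB := nbhs_singleton Ba.
apply: filterS2 Ba (nbhsx_ballx a (e / C) eC) => b Bb.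
rewrite -ball_normE /= ltr_pdivlMr // => ab.
apply: le_trans (fC (a, b) (conj aB Bb)) _.
by rewrite /= mulrC ltW.
Qed.

Lemma Ck1loc_Ck k A f : Ck1loc k A f -> Ck k A f.
Proof.
elim: k f => [|k IH] f; first exact: locally_lipschitz_continuous.
by case=> df pf; split=> // i; exact/IH/pf.
Qed.

Lemma locally_lipschitzD A f g : locally_lipschitz A f -> locally_lipschitz A g ->
  locally_lipschitz A (fun v => f v + g v).
Proof.
move=> lf lg a Aa; have [B Ba /pinfty_ex_gt0[C C0 fC]] := lf a Aa.
have [B' B'a /pinfty_ex_gt0[C' C'0 gC]] := lg a Aa.
exists (B `&` B'); first exact: filterI.
apply: (@lipschitz_bound _ _ _ _ (C + C') a).
  by split; exact: nbhs_singleton.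
move=> b c [Bb B'b] [Bc B'c]; rewrite opprD addrACA mulrDl.
apply: le_trans (ler_normD _ _) (lerD _ _).
  exact: (fC (c, b)).
exact: (gC (c, b)).
Qed.

Lemma eq_locally_lipschitz A f g : open A -> (forall a, A a -> f a = g a) ->
  locally_lipschitz A f -> locally_lipschitz A g.
Proof.
move=> oA fg lf a Aa; have [B Ba /pinfty_ex_gt0[C C0 fC]] := lf a Aa.
exists (B `&` A); first by apply: filterI => //; exact: open_nbhs_nbhs.
apply: (@lipschitz_bound _ _ _ _ C a).
  by split=> //; exact: nbhs_singleton.
by move=> b c [Bb Ab] [Bc Ac]; rewrite -!fg //; exact: (fC (c, b)).
Qed.

Lemma eq_Ck1loc k A f g : open A -> (forall a, A a -> f a = g a) ->
  Ck1loc k A f -> Ck1loc k A g.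
Proof. by apply: eq_iter_differentiable; apply: eq_locally_lipschitz. Qed.

Lemma Ck1locD k A f g : open A -> Ck1loc k A f -> Ck1loc k A g ->
  Ck1loc k A (fun v => f v + g v).
Proof.
move=> oA; elim: k f g => [|k IH] f g; first exact: locally_lipschitzD.
move=> [df pf] [dg pg]; split=> [a Aa|i].
  exact: (differentiableD (df a Aa) (dg a Aa)).
apply: eq_Ck1loc (IH _ _ (pf i) (pg i)) => // a Aa.
by rewrite pderivD //; [exact: df|exact: dg].
Qed.

End SmoothFunctions.

(** * Symmetry of second derivatives *)

Section Schwarz.
Variables (R : realType) (m : nat).
Implicit Types (A : set 'rV[R]_m) (f g : 'rV[R]_m -> R) (a b v w : 'rV[R]_m).

Lemma pderiv_shift f w a i : pderiv i (fun v => f (v + w)) a = pderiv i f (a + w).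
Proof.
rewrite /pderiv /derive.
apply: (congr1 (fun F : R -> R => lim (F @ 0^'))); apply/funext => h /=.
by rewrite addrA.
Qed.

Lemma differentiable_shift f w a : differentiable f (a + w) ->
  differentiable (fun v => f (v + w)) a.
Proof.
move=> df; exact: (@differentiable_comp _ _ _ _ (fun v => v + w) f).
Qed.

(** The mean value theorem is applied twice: to the increment [phi] of [f] in direction [j], along
    direction [i], and then to [pderiv i f] along direction [j]. Both displacements have norm at
    most [r], hence the radius [r + r]. *)
Lemma second_difference A f a i j (r : R) : 0 < r ->
  (forall v, `|v| <= r + r -> A (a + v)) -> Ck 2 A f ->
  exists2 v, `|v| <= r + r &
    f (a + r *: delta_mx 0 i + r *: delta_mx 0 j) - f (a + r *: delta_mx 0 i) -
      f (a + r *: delta_mx 0 j) + f a = r ^+ 2 * pderiv j (pderiv i f) (a + v).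
Proof.
move=> r0 Aa [df pf].
have nr k (t : R) : 0 <= t <= 1 -> `|t *: (r *: delta_mx 0 k : 'rV[R]_m)| <= r.
  move=> /andP[t0 t1]; rewrite !normrZ ger0_norm // gtr0_norm //.
  rewrite mulrA -[leRHS]mulr1; apply: ler_pM; rewrite ?norm_delta_mx_le1 //.
    by rewrite mulr_ge0 // ltW.
  by rewrite -[leRHS]mul1r ler_wpM2r // ltW.
have n1 k : `|r *: delta_mx 0 k : 'rV[R]_m| <= r.
  by rewrite -[X in `|X|]scale1r; apply: nr; rewrite ler01 lexx.
have rr v : `|v| <= r -> `|v| <= r + r by move=> /le_trans; apply; rewrite lerDl ltW.
pose ej : 'rV[R]_m := r *: delta_mx 0 j; pose ei : 'rV[R]_m := r *: delta_mx 0 i.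
pose phi v := f (v + ej) - f v.
have dphi (t : R) : 0 <= t <= 1 -> differentiable phi (a + t *: ei).
  move=> t01; apply: differentiableB.
    apply: differentiable_shift; apply: df; rewrite -addrA; apply: Aa.
    by apply: le_trans (ler_normD _ _) (lerD _ _); [exact: nr|exact: n1].
  by apply/df/Aa/rr/nr.
have [t t01 E] := mean_value dphi.
have Ai (s : R) : 0 <= s <= 1 -> A (a + t *: ei + s *: ej).
  move=> s01; rewrite -addrA; apply: Aa.
  by apply: le_trans (ler_normD _ _) (lerD _ _); exact: nr.
have [s s01 E'] := @mean_value _ _ (pderiv i f) (a + t *: ei) ej
  (fun s s01 => (pf i).1 _ (Ai s s01)).
exists (t *: ei + s *: ej).
  by apply: le_trans (ler_normD _ _) (lerD _ _); exact: nr.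
have Ai0 : A (a + t *: ei) by have := Ai 0; rewrite scale0r addr0; apply; rewrite lexx ler01.
have Ai1 : A (a + t *: ei + ej) by have := Ai 1; rewrite scale1r; apply; rewrite lexx ler01.
rewrite addrA; transitivity (phi (a + ei) - phi a); first by rewrite /phi /ei /ej; ring.
rewrite E {1}/ei linearZ /= -pderivE; last exact: dphi.
have -> : pderiv i phi (a + t *: ei) = pderiv i f (a + t *: ei + ej) - pderiv i f (a + t *: ei).
  rewrite /phi pderivD; [|by apply: differentiable_shift; exact: df|by apply: differentiableN; exact: df].
  by rewrite pderiv_shift pderivN //; exact: df.
rewrite E' {1}/ej linearZ /= -pderivE; last by apply: (pf i).1; exact: Ai.
by rewrite expr2 -!mulrA.
Qed.

(** The second difference is symmetric in [i] and [j], so the two mixed derivatives take the same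
    value at two possibly different points near [a]. Continuity compares these with the values at
    [a], up to [e / 2] each. *)
Lemma pderiv_comm A f a i j : open A -> A a -> Ck 2 A f ->
  pderiv i (pderiv j f) a = pderiv j (pderiv i f) a.
Proof.
move=> oA Aa Cf; apply/eqP; rewrite -subr_eq0 -normr_le0; apply/ler_addgt0Pr => e e0.
rewrite add0r.
have e2 : 0 < e / 2 by rewrite divr_gt0.
have cont k l : exists2 r, 0 < r & forall v, `|v| < r ->
    A (a + v) /\ `|pderiv k (pderiv l f) a - pderiv k (pderiv l f) (a + v)| <= e / 2.
  have [_ /(_ l)[_ /(_ k) ck]] := Cf.
  have /(@cvgrPdist_le _ _ _ (nbhs a)) /(_ _ e2) ca := ck a Aa.
  have na : nbhs a [set b | A b /\ `|pderiv k (pderiv l f) a - pderiv k (pderiv l f) b| <= e / 2].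
    exact: filterI (open_nbhs_nbhs (conj oA Aa)) ca.
  have /nbhs_ballP[r /= r0 rP] := na.
  exists r => // v vr; apply: rP.
  by rewrite -ball_normE /= opprD addrA subrr add0r normrN.
have [r r0 Pr] := cont i j; have [r' r'0 Pr'] := cont j i.
(* A quarter of the minimum, so that points at distance at most [q + q] lie strictly inside both
   balls. *)
pose q := Num.min r r' / 4.
have q0 : 0 < q by rewrite divr_gt0 // lt_min r0.
have mr : Num.min r r' <= r by rewrite ge_min lexx.
have mr' : Num.min r r' <= r' by rewrite ge_min lexx orbT.
have qr v : `|v| <= q + q -> `|v| < r.
  by move=> /le_lt_trans; apply; rewrite /q in q0 *; lra.
have qr' v : `|v| <= q + q -> `|v| < r'.
  by move=> /le_lt_trans; apply; rewrite /q in q0 *; lra.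
have Aq v : `|v| <= q + q -> A (a + v) by move=> /qr /Pr[].
have [v vq Ev] := second_difference j i q0 Aq Cf.
have [w wq Ew] := second_difference i j q0 Aq Cf.
have E : pderiv i (pderiv j f) (a + v) = pderiv j (pderiv i f) (a + w).
  apply: (mulfI (expf_neq0 2 (lt0r_neq0 q0))).
  have Eij : a + q *: delta_mx 0 i + q *: delta_mx 0 j = a + q *: delta_mx 0 j + q *: delta_mx 0 i.
    exact: addrAC.
  by rewrite -Ev -Ew Eij [X in X + _ = _]addrAC.
have [_ h1] := Pr _ (qr _ vq); have [_ h2] := Pr' _ (qr' _ wq).
have tri (u1 u2 w1 w2 : R) : w1 = w2 -> `|u1 - w1| <= e / 2 -> `|u2 - w2| <= e / 2 ->
    `|u1 - u2| <= e.
  move=> -> le1 le2; rewrite [e]splitr; apply: le_trans (ler_distD w2 u1 u2) _.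
  by rewrite (distrC w2); exact: lerD.
exact: tri E h1 h2.
Qed.

End Schwarz.

(** * Smooth complex-valued functions *)

Section ComplexSmooth.
Variables (R : realType).
Implicit Types (A : set 'rV[R]_2) (G H : 'rV[R]_2 -> R[i]) (j : 'I_2).

Lemma eq_CsmoothC A G H : open A -> (forall v, A v -> G v = H v) ->
  CsmoothC A G -> CsmoothC A H.
Proof.
move=> oA GH [rG iG]; split=> k; [apply: eq_Ck (rG k)|apply: eq_Ck (iG k)] => // v /GH -> //.
Qed.

Lemma CsmoothC_cst A (c : R[i]) : open A -> CsmoothC A (fun=> c).
Proof. by move=> oA; split=> k; exact: Ck_cst. Qed.

Lemma CsmoothC_toC A : open A -> CsmoothC A (@toC R).
Proof. by move=> oA; split=> k; exact: Ck_coord. Qed.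

Lemma CsmoothCD A G H : open A -> CsmoothC A G -> CsmoothC A H ->
  CsmoothC A (fun v => G v + H v).
Proof.
move=> oA [rG iG] [rH iH]; split=> k.
  rewrite (_ : (fun v => _) = (fun v => complex.Re (G v) + complex.Re (H v))).
    exact: CkD.
  by apply/funext => v; case: (G v) (H v) => ? ? [].
rewrite (_ : (fun v => _) = (fun v => complex.Im (G v) + complex.Im (H v))).
  exact: CkD.
by apply/funext => v; case: (G v) (H v) => ? ? [].
Qed.

Lemma CsmoothCM A G H : open A -> CsmoothC A G -> CsmoothC A H ->
  CsmoothC A (fun v => G v * H v).
Proof.
move=> oA [rG iG] [rH iH]; split=> k.
  rewrite (_ : (fun v => _) = (fun v => complex.Re (G v) * complex.Re (H v)
     + - (complex.Im (G v) * complex.Im (H v)))).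
    by apply: CkD => //; [|apply: CkN => //]; apply: CkM.
  by apply/funext => v; case: (G v) (H v) => ? ? [].
rewrite (_ : (fun v => _) = (fun v => complex.Re (G v) * complex.Im (H v)
   + complex.Im (G v) * complex.Re (H v))).
  by apply: CkD => //; apply: CkM.
by apply/funext => v; case: (G v) (H v) => ? ? [].
Qed.

Lemma CsmoothC_conj A G : open A -> CsmoothC A G -> CsmoothC A (fun v => conjc (G v)).
Proof.
move=> oA [rG iG]; split=> k.
  rewrite (_ : (fun v => _) = (fun v => complex.Re (G v))) //.
  by apply/funext => v; case: (G v).
rewrite (_ : (fun v => _) = (fun v => - complex.Im (G v))); first exact: CkN.
by apply/funext => v; case: (G v).
Qed.

Lemma CsmoothCN A G : open A -> CsmoothC A G -> CsmoothC A (fun v => - G v).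
Proof.
move=> oA sG; rewrite (_ : (fun v => _) = (fun v => (-1) * G v)).
  by apply: CsmoothCM => //; exact: CsmoothC_cst.
by apply/funext => v; rewrite mulN1r.
Qed.

Lemma CsmoothCX A G n : open A -> CsmoothC A G -> CsmoothC A (fun v => G v ^+ n).
Proof.
move=> oA sG; elim: n => [|n IH]; first exact: CsmoothC_cst.
rewrite (_ : (fun v => _) = (fun v => G v * G v ^+ n)); first exact: CsmoothCM.
by apply/funext => v; rewrite exprS.
Qed.

Lemma CsmoothC_sum A (I : Type) (s : seq I) (F : I -> 'rV[R]_2 -> R[i]) : open A ->
  (forall i, CsmoothC A (F i)) -> CsmoothC A (fun v => \sum_(i <- s) F i v).
Proof.
move=> oA sF; elim: s => [|i s IH].
  rewrite (_ : (fun v => _) = (fun=> 0)); first exact: CsmoothC_cst.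
  by apply/funext => v; rewrite big_nil.
rewrite (_ : (fun v => _) = (fun v => F i v + \sum_(i <- s) F i v)); first exact: CsmoothCD.
by apply/funext => v; rewrite big_cons.
Qed.

Lemma CsmoothC_real A (f : 'rV[R]_2 -> R) : open A -> Csmooth A f ->
  CsmoothC A (fun v => (f v)%:C).
Proof. by move=> oA sf; split=> k; [exact: sf|exact: Ck_cst]. Qed.

(** Reduction to the real inverse: [G^-1 = conj G / n] with [n = |G|^2]. *)
Lemma CsmoothCV A G : open A -> (forall v, A v -> G v != 0) -> CsmoothC A G ->
  CsmoothC A (fun v => (G v)^-1).
Proof.
move=> oA G0 sG; have [rG iG] := sG.
pose n v := complex.Re (G v) * complex.Re (G v) + complex.Im (G v) * complex.Im (G v).
have nE v : (n v)%:C = G v * conjc (G v).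
  rewrite /n; case: (G v) => x y /=; apply/eqP; rewrite eq_complex /=.
  by apply/andP; split; apply/eqP; ring.
have n0 v : A v -> n v != 0.
  move=> /G0 Gv; apply: contra_neq Gv => nv; apply/eqP.
  have /eqP := nE v; rewrite nv eq_sym mulf_eq0 conjc_eq0 orbb //.
apply: (@eq_CsmoothC _ (fun v => conjc (G v) * ((n v)^-1)%:C)) => //.
  move=> v Av; have := n0 v Av; have := G0 v Av; have := nE v.
  move: (n v) (G v) => r g E g0 r0.
  have g0' : conjc g != 0 by rewrite conjc_eq0.
  rewrite fmorphV /= E invfM mulrCA mulfV ?mulr1 //.
apply: CsmoothCM => //; first exact: CsmoothC_conj.
apply: CsmoothC_real => // k.
by apply: CkV => //; apply: CkD => //; apply: CkM.
Qed.

Lemma CsmoothC_pderivC A G j : CsmoothC A G -> CsmoothC A (pderivC j G).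
Proof. by move=> [rG iG]; split=> k; [have [_] := rG k.+1|have [_] := iG k.+1]; apply. Qed.

Lemma eq_pderivC A G H j : open A -> (forall v, A v -> G v = H v) ->
  forall v, A v -> pderivC j G v = pderivC j H v.
Proof.
move=> oA GH v Av; rewrite /pderivC.
by congr (_ +i* _); apply: eq_pderiv oA _ v Av => w /GH ->.
Qed.

Lemma pderivC_cst (c : R[i]) j v : pderivC j (fun=> c) v = 0.
Proof. by rewrite /pderivC !pderiv_cst. Qed.

Lemma pderivC_conj A G j v : CsmoothC A G -> A v ->
  pderivC j (fun w => conjc (G w)) v = conjc (pderivC j G v).
Proof.
move=> [rG iG] Av; rewrite /pderivC /=.
rewrite (_ : (fun w => complex.Re _) = (fun w => complex.Re (G w))); last first.
  by apply/funext => w; case: (G w).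
rewrite (_ : (fun w => complex.Im _) = (fun w => - complex.Im (G w))); last first.
  by apply/funext => w; case: (G w).
by rewrite pderivN //; exact: (Ck_differentiable (iG 1%N)).
Qed.

Lemma pderivCD A G H j v : CsmoothC A G -> CsmoothC A H -> A v ->
  pderivC j (fun w => G w + H w) v = pderivC j G v + pderivC j H v.
Proof.
move=> [rG iG] [rH iH] Av; rewrite /pderivC.
rewrite (_ : (fun w => complex.Re _) = (fun w => complex.Re (G w) + complex.Re (H w))); last first.
  by apply/funext => w; case: (G w) (H w) => ? ? [].
rewrite (_ : (fun w => complex.Im _) = (fun w => complex.Im (G w) + complex.Im (H w))); last first.
  by apply/funext => w; case: (G w) (H w) => ? ? [].
have dRG := Ck_differentiable (rG 1%N) Av; have dIG := Ck_differentiable (iG 1%N) Av.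
have dRH := Ck_differentiable (rH 1%N) Av; have dIH := Ck_differentiable (iH 1%N) Av.
by rewrite !pderivD.
Qed.

Lemma pderivCM A G H j v : CsmoothC A G -> CsmoothC A H -> A v ->
  pderivC j (fun w => G w * H w) v = pderivC j G v * H v + G v * pderivC j H v.
Proof.
move=> [rG iG] [rH iH] Av; rewrite /pderivC.
rewrite (_ : (fun w => complex.Re _) = (fun w => complex.Re (G w) * complex.Re (H w)
  + - (complex.Im (G w) * complex.Im (H w)))); last first.
  by apply/funext => w; case: (G w) (H w) => ? ? [].
rewrite (_ : (fun w => complex.Im _) = (fun w => complex.Re (G w) * complex.Im (H w)
  + complex.Im (G w) * complex.Re (H w))); last first.
  by apply/funext => w; case: (G w) (H w) => ? ? [].
have dRG := Ck_differentiable (rG 1%N) Av; have dIG := Ck_differentiable (iG 1%N) Av.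
have dRH := Ck_differentiable (rH 1%N) Av; have dIH := Ck_differentiable (iH 1%N) Av.
rewrite (pderivD _ (differentiableM dRG dRH) (differentiableN (differentiableM dIG dIH))).
rewrite (pderivN _ (differentiableM dIG dIH)).
rewrite (pderivD _ (differentiableM dRG dIH) (differentiableM dIG dRH)) !pderivM //.
case: (G v) (H v) => x y [x' y'] /=; apply/eqP; rewrite eq_complex /=.
by apply/andP; split; apply/eqP; ring.
Qed.

Lemma pderivC_toC j v : pderivC j (@toC R) v = if j == 0 then 1 else 'i%C.
Proof.
rewrite /pderivC /= !pderiv_coord.
by case: j => -[|[|//]] ?; apply/eqP; rewrite eq_complex /= !eqxx.
Qed.

Lemma pderivCX A G n j v : open A -> CsmoothC A G -> A v ->
  pderivC j (fun w => G w ^+ n) v = n%:R * G v ^+ n.-1 * pderivC j G v.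
Proof.
move=> oA sG Av; elim: n => [|n IH].
  by rewrite (_ : (fun w => _) = (fun=> 1)) // pderivC_cst !mul0r.
rewrite (_ : (fun w => _) = (fun w => G w * G w ^+ n)); last first.
  by apply/funext => w; rewrite exprS.
rewrite (pderivCM _ sG (CsmoothCX n oA sG) Av) IH /=.
case: n {IH} => [|n] /=; first by rewrite expr0; ring.
rewrite -[n.+2%:R]natr1 exprS; ring.
Qed.

(** Differentiation of [G * G^-1 = 1], an identity that holds on [A] only. *)
Lemma pderivCV A G j v : open A -> (forall w, A w -> G w != 0) -> CsmoothC A G -> A v ->
  pderivC j (fun w => (G w)^-1) v = - (pderivC j G v / G v ^+ 2).
Proof.
move=> oA G0 sG Av; have := pderivCM j sG (CsmoothCV oA G0 sG) Av.
rewrite (@eq_pderivC A _ (fun=> 1) j oA _ v Av); last by move=> w Aw; rewrite mulfV ?G0.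
rewrite pderivC_cst => /esym/eqP; rewrite addrC addr_eq0 => /eqP E.
have Gv := G0 v Av; apply: (mulfI Gv); rewrite E.
by field.
Qed.

Lemma pderivCC A G i j v : open A -> CsmoothC A G -> A v ->
  pderivC i (pderivC j G) v = pderivC j (pderivC i G) v.
Proof.
move=> oA [rG iG] Av; rewrite /pderivC /=.
by rewrite (pderiv_comm i j oA Av (rG 2%N)) (pderiv_comm i j oA Av (iG 2%N)).
Qed.

End ComplexSmooth.

(** * Wirtinger derivatives *)

Section ConjC.
Variable R : realType.
Implicit Types u v : R[i].

Lemma conjcD u v : conjc (u + v) = conjc u + conjc v. Proof. exact: (rmorphD conjc). Qed.
Lemma conjcB u v : conjc (u - v) = conjc u - conjc v. Proof. exact: (rmorphB conjc). Qed.
Lemma conjcM u v : conjc (u * v) = conjc u * conjc v. Proof. exact: (rmorphM conjc). Qed.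
Lemma conjcX u n : conjc (u ^+ n) = conjc u ^+ n. Proof. exact: (rmorphXn conjc). Qed.
Lemma mulcii : ('i%C * 'i%C : R[i]) = -1. Proof. by rewrite -expr2 sqr_i. Qed.

Lemma conjci : conjc 'i%C = - 'i%C :> R[i].
Proof. by apply/eqP; rewrite eq_complex /= oppr0 !eqxx. Qed.

End ConjC.

Section Wirtinger.
Variables (R : realType) (A : set 'rV[R]_2).
Hypothesis oA : open A.
Implicit Types (G H : 'rV[R]_2 -> R[i]) (j : 'I_2).

Lemma eq_dz G H : (forall v, A v -> G v = H v) -> forall v, A v -> dz G v = dz H v.
Proof.
by move=> GH v Av; rewrite /dz (eq_pderivC 0 oA GH Av) (eq_pderivC 1 oA GH Av).
Qed.

Lemma eq_dzbar G H : (forall v, A v -> G v = H v) ->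
  forall v, A v -> dzbar G v = dzbar H v.
Proof.
by move=> GH v Av; rewrite /dzbar (eq_pderivC 0 oA GH Av) (eq_pderivC 1 oA GH Av).
Qed.

Lemma CsmoothC_dz G : CsmoothC A G -> CsmoothC A (dz G).
Proof.
move=> sG; have s0 := CsmoothC_pderivC 0 sG; have s1 := CsmoothC_pderivC 1 sG.
apply: (CsmoothCM oA (CsmoothC_cst _ oA)); apply: (CsmoothCD oA s0).
by apply: CsmoothCN => //; exact: (CsmoothCM oA (CsmoothC_cst _ oA)).
Qed.

Lemma CsmoothC_dzbar G : CsmoothC A G -> CsmoothC A (dzbar G).
Proof.
move=> sG; have s0 := CsmoothC_pderivC 0 sG; have s1 := CsmoothC_pderivC 1 sG.
apply: (CsmoothCM oA (CsmoothC_cst _ oA)); apply: (CsmoothCD oA s0).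
exact: (CsmoothCM oA (CsmoothC_cst _ oA)).
Qed.

Lemma dz_cst (c : R[i]) v : dz (fun=> c) v = 0.
Proof. by rewrite /dz !pderivC_cst; ring. Qed.

Lemma dzbar_cst (c : R[i]) v : dzbar (fun=> c) v = 0.
Proof. by rewrite /dzbar !pderivC_cst; ring. Qed.

Local Lemma wirtingerD (c u1 u2 v1 v2 : R[i]) :
  c * (u1 + u2 - 'i%C * (v1 + v2)) = c * (u1 - 'i%C * v1) + c * (u2 - 'i%C * v2).
Proof. ring. Qed.

Local Lemma wirtinger_barD (c u1 u2 v1 v2 : R[i]) :
  c * (u1 + u2 + 'i%C * (v1 + v2)) = c * (u1 + 'i%C * v1) + c * (u2 + 'i%C * v2).
Proof. ring. Qed.

Local Lemma wirtingerM (c g h u1 u2 v1 v2 : R[i]) :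
  c * (u1 * h + g * u2 - 'i%C * (v1 * h + g * v2)) =
  c * (u1 - 'i%C * v1) * h + g * (c * (u2 - 'i%C * v2)).
Proof. ring. Qed.

Local Lemma wirtinger_barM (c g h u1 u2 v1 v2 : R[i]) :
  c * (u1 * h + g * u2 + 'i%C * (v1 * h + g * v2)) =
  c * (u1 + 'i%C * v1) * h + g * (c * (u2 + 'i%C * v2)).
Proof. ring. Qed.

Lemma dzD G H v : CsmoothC A G -> CsmoothC A H -> A v ->
  dz (fun w => G w + H w) v = dz G v + dz H v.
Proof. by move=> sG sH Av; rewrite /dz !(pderivCD _ sG sH Av); exact: wirtingerD. Qed.

Lemma dzbarD G H v : CsmoothC A G -> CsmoothC A H -> A v ->
  dzbar (fun w => G w + H w) v = dzbar G v + dzbar H v.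
Proof. by move=> sG sH Av; rewrite /dzbar !(pderivCD _ sG sH Av); exact: wirtinger_barD. Qed.

Lemma dzM G H v : CsmoothC A G -> CsmoothC A H -> A v ->
  dz (fun w => G w * H w) v = dz G v * H v + G v * dz H v.
Proof. by move=> sG sH Av; rewrite /dz !(pderivCM _ sG sH Av); exact: wirtingerM. Qed.

Lemma dzbarM G H v : CsmoothC A G -> CsmoothC A H -> A v ->
  dzbar (fun w => G w * H w) v = dzbar G v * H v + G v * dzbar H v.
Proof. by move=> sG sH Av; rewrite /dzbar !(pderivCM _ sG sH Av); exact: wirtinger_barM. Qed.

Lemma dzZ c G v : CsmoothC A G -> A v -> dz (fun w => c * G w) v = c * dz G v.
Proof.
by move=> sG Av; rewrite (dzM (CsmoothC_cst c oA) sG Av) dz_cst mul0r add0r.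
Qed.

Lemma dzbarZ c G v : CsmoothC A G -> A v -> dzbar (fun w => c * G w) v = c * dzbar G v.
Proof.
by move=> sG Av; rewrite (dzbarM (CsmoothC_cst c oA) sG Av) dzbar_cst mul0r add0r.
Qed.

Lemma dzbar_conj G v : CsmoothC A G -> A v ->
  dzbar (fun w => conjc (G w)) v = conjc (dz G v).
Proof.
move=> sG Av; rewrite /dz /dzbar !(pderivC_conj _ sG Av).
rewrite conjcM conjcB conjcM conjc_inv conjc_nat.
by rewrite conjci mulNr ?opprK.
Qed.

Lemma dz_conj G v : CsmoothC A G -> A v ->
  dz (fun w => conjc (G w)) v = conjc (dzbar G v).
Proof.
move=> sG Av; rewrite /dz /dzbar !(pderivC_conj _ sG Av).
rewrite conjcM conjcD conjcM conjc_inv conjc_nat.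
by rewrite conjci mulNr ?opprK.
Qed.

Lemma dz_toC v : dz (@toC R) v = 1.
Proof.
rewrite /dz !pderivC_toC /= mulcii opprK -[1 + 1]/(2%:R) mulVf //; by rewrite pnatr_eq0.
Qed.

Lemma dzbar_toC v : dzbar (@toC R) v = 0.
Proof. by rewrite /dzbar !pderivC_toC /= mulcii subrr mulr0. Qed.

Lemma sum_dz_dzbar G v : pderivC 0 G v = dz G v + dzbar G v.
Proof.
rewrite /dz /dzbar -mulrDr; set a := pderivC 0 G v; set b := pderivC 1 G v.
move: a b => a b; have -> : a - 'i%C * b + (a + 'i%C * b) = 2%:R * a by ring.
by rewrite mulrA mulVf ?pnatr_eq0 // mul1r.
Qed.

Lemma diff_dz_dzbar G v : pderivC 1 G v = 'i%C * (dz G v - dzbar G v).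
Proof.
rewrite /dz /dzbar -mulrBr; set a := pderivC 0 G v; set b := pderivC 1 G v.
move: a b => a b; have -> : a - 'i%C * b - (a + 'i%C * b) = 2%:R * - ('i%C * b) by ring.
by rewrite (mulrA 2%:R^-1) mulVf ?pnatr_eq0 // mul1r mulrN mulrA mulcii mulN1r opprK.
Qed.

(** Both operators have constant coefficients, so this is the symmetry of second partial
    derivatives. *)
Lemma dz_dzbarC G v : CsmoothC A G -> A v -> dz (dzbar G) v = dzbar (dz G) v.
Proof.
move=> sG Av; have s0 := CsmoothC_pderivC 0 sG; have s1 := CsmoothC_pderivC 1 sG.
have ss c : CsmoothC A (fun w => c * pderivC 1 G w) by exact: (CsmoothCM oA (CsmoothC_cst _ oA)).
(* [c] is [i] for [dzbar] and [-i] for [dz], so one formula serves both operators. *)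
have pz (c : R[i]) j : pderivC j (fun w => 2%:R^-1 * (pderivC 0 G w + c * pderivC 1 G w)) v =
    2%:R^-1 * (pderivC j (pderivC 0 G) v + c * pderivC j (pderivC 1 G) v).
  rewrite (pderivCM _ (CsmoothC_cst _ oA) (CsmoothCD oA s0 (ss c)) Av) pderivC_cst.
  rewrite (pderivCD _ s0 (ss c) Av) (pderivCM _ (CsmoothC_cst _ oA) s1 Av) pderivC_cst.
  by rewrite !mul0r !add0r.
have -> : dz G = fun w => 2%:R^-1 * (pderivC 0 G w + (- 'i%C) * pderivC 1 G w).
  by apply/funext => w; rewrite mulNr.
rewrite /dz /dzbar !pz (pderivCC 1 0 oA sG Av).
move: (pderivC 0 _ _) (pderivC 0 _ _) (pderivC 1 _ _) => a b c.
by ring.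
Qed.

Lemma eq_iter_dz n G H : (forall v, A v -> G v = H v) ->
  forall v, A v -> iter n (@dz R) G v = iter n (@dz R) H v.
Proof. by move=> GH; elim: n => [|n IH] v Av; [exact: GH|exact: (eq_dz IH Av)]. Qed.

Lemma eq_iter_dzbar n G H : (forall v, A v -> G v = H v) ->
  forall v, A v -> iter n (@dzbar R) G v = iter n (@dzbar R) H v.
Proof. by move=> GH; elim: n => [|n IH] v Av; [exact: GH|exact: (eq_dzbar IH Av)]. Qed.

Lemma CsmoothC_iter_dz n G : CsmoothC A G -> CsmoothC A (iter n (@dz R) G).
Proof. by move=> sG; elim: n => //= n; exact: CsmoothC_dz. Qed.

Lemma CsmoothC_iter_dzbar n G : CsmoothC A G -> CsmoothC A (iter n (@dzbar R) G).
Proof. by move=> sG; elim: n => //= n; exact: CsmoothC_dzbar. Qed.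

Lemma iter_dzD n G H v : CsmoothC A G -> CsmoothC A H -> A v ->
  iter n (@dz R) (fun w => G w + H w) v = iter n (@dz R) G v + iter n (@dz R) H v.
Proof.
move=> sG sH; elim: n v => //= n IH v Av; rewrite (eq_dz IH Av).
by rewrite (dzD (CsmoothC_iter_dz n sG) (CsmoothC_iter_dz n sH) Av).
Qed.

Lemma iter_dzbarD n G H v : CsmoothC A G -> CsmoothC A H -> A v ->
  iter n (@dzbar R) (fun w => G w + H w) v =
  iter n (@dzbar R) G v + iter n (@dzbar R) H v.
Proof.
move=> sG sH; elim: n v => //= n IH v Av; rewrite (eq_dzbar IH Av).
by rewrite (dzbarD (CsmoothC_iter_dzbar n sG) (CsmoothC_iter_dzbar n sH) Av).
Qed.

Lemma iter_dzZ n c G v : CsmoothC A G -> A v ->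
  iter n (@dz R) (fun w => c * G w) v = c * iter n (@dz R) G v.
Proof.
move=> sG; elim: n v => //= n IH v Av; rewrite (eq_dz IH Av).
by rewrite (dzZ _ (CsmoothC_iter_dz n sG) Av).
Qed.

Lemma iter_dzbarZ n c G v : CsmoothC A G -> A v ->
  iter n (@dzbar R) (fun w => c * G w) v = c * iter n (@dzbar R) G v.
Proof.
move=> sG; elim: n v => //= n IH v Av; rewrite (eq_dzbar IH Av).
by rewrite (dzbarZ _ (CsmoothC_iter_dzbar n sG) Av).
Qed.

(** * Multiplication by z and zbar under iterated Wirtinger derivatives *)

Let sz : CsmoothC A (@toC R) := CsmoothC_toC oA.
Let szb : CsmoothC A (fun v => conjc (toC v)) := CsmoothC_conj oA sz.

(** Leibniz' rule for a factor with first derivative 1 and higher derivatives 0. For [n = 0] the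
    truncated [n.-1] is harmless, its coefficient being 0. *)
Lemma iter_dzMz n G v : CsmoothC A G -> A v ->
  iter n (@dz R) (fun w => toC w * G w) v =
  n%:R * iter n.-1 (@dz R) G v + toC v * iter n (@dz R) G v.
Proof.
move=> sG; elim: n v => [|n IH] v Av; first by rewrite mul0r add0r.
rewrite iterS (eq_dz IH Av); have si k := CsmoothC_iter_dz k sG.
rewrite (dzD (CsmoothCM oA (CsmoothC_cst _ oA) (si _)) (CsmoothCM oA sz (si _)) Av).
rewrite (dzZ _ (si _) Av) (dzM sz (si _) Av) dz_toC mul1r addrA -natr1 mulrDl mul1r.
congr (_ + _ + _); case: n {IH} => [|n]; first by rewrite !mul0r.
by rewrite -iterS.
Qed.

Lemma iter_dzbarMz n G v : CsmoothC A G -> A v ->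
  iter n (@dzbar R) (fun w => toC w * G w) v = toC v * iter n (@dzbar R) G v.
Proof.
move=> sG; elim: n v => //= n IH v Av; rewrite (eq_dzbar IH Av).
by rewrite (dzbarM sz (CsmoothC_iter_dzbar n sG) Av) dzbar_toC mul0r add0r.
Qed.

Lemma dzbar_zbar v : A v -> dzbar (fun w => conjc (toC w)) v = 1.
Proof. by move=> Av; rewrite (dzbar_conj sz Av) dz_toC conjc1. Qed.

Lemma dz_zbar v : A v -> dz (fun w => conjc (toC w)) v = 0.
Proof. by move=> Av; rewrite (dz_conj sz Av) dzbar_toC conjc0. Qed.

Lemma iter_dzbarMzbar n G v : CsmoothC A G -> A v ->
  iter n (@dzbar R) (fun w => conjc (toC w) * G w) v =
  n%:R * iter n.-1 (@dzbar R) G v + conjc (toC v) * iter n (@dzbar R) G v.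
Proof.
move=> sG; elim: n v => [|n IH] v Av; first by rewrite mul0r add0r.
rewrite iterS (eq_dzbar IH Av); have si k := CsmoothC_iter_dzbar k sG.
rewrite (dzbarD (CsmoothCM oA (CsmoothC_cst _ oA) (si _)) (CsmoothCM oA szb (si _)) Av).
rewrite (dzbarZ _ (si _) Av) (dzbarM szb (si _) Av) (dzbar_zbar Av) mul1r addrA -natr1 mulrDl mul1r.
congr (_ + _ + _); case: n {IH} => [|n]; first by rewrite !mul0r.
by rewrite -iterS.
Qed.

Lemma iter_dzMzbar n G v : CsmoothC A G -> A v ->
  iter n (@dz R) (fun w => conjc (toC w) * G w) v = conjc (toC v) * iter n (@dz R) G v.
Proof.
move=> sG; elim: n v => //= n IH v Av; rewrite (eq_dz IH Av).
by rewrite (dzM szb (CsmoothC_iter_dz n sG) Av) (dz_zbar Av) mul0r add0r.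
Qed.

Lemma iter_dzbar_dz n G v : CsmoothC A G -> A v ->
  iter n (@dzbar R) (dz G) v = dz (iter n (@dzbar R) G) v.
Proof.
move=> sG; elim: n v => //= n IH v Av; rewrite (eq_dzbar IH Av).
by rewrite (dz_dzbarC (CsmoothC_iter_dzbar n sG) Av).
Qed.

End Wirtinger.

(** * Jets at 0 *)

(** The cancellation behind the Taylor coefficients in [zbar_division]: there [z = a! b!] is the
    product of the falling factorial [x = b ^_ s] and of [w = a! (b - s)!]. *)
Lemma mulr_divK (K : fieldType) (x y z w : K) : z != 0 -> z = x * w ->
  x * (y / z * w) = y.
Proof.
move=> z0 E; have -> : x * (y / z * w) = y * ((x * w) / z) by ring.
by rewrite -E divff // mulr1.
Qed.

Section Jets.
Variables (R : realType) (A : set 'rV[R]_2).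
Hypotheses (oA : open A) (A0 : A 0).
Implicit Types (G H : 'rV[R]_2 -> R[i]) (j : 'I_2).

(** Up to the factor [a! b!], the coefficient of [z^a zbar^b] in the Taylor expansion of a smooth
    [G] at 0. *)
Definition jet a b G : R[i] := iter a (@dz R) (iter b (@dzbar R) G) 0.

Let zbar (v : 'rV[R]_2) : R[i] := conjc (toC v).
Let sz : CsmoothC A (@toC R) := CsmoothC_toC oA.
Let szb : CsmoothC A zbar := CsmoothC_conj oA sz.
Let scst c : CsmoothC A (fun=> c) := CsmoothC_cst c oA.

Lemma toC0 : toC (0 : 'rV[R]_2) = 0.
Proof. by rewrite /toC !mxE. Qed.

Lemma eq_jet a b G H : (forall v, A v -> G v = H v) -> jet a b G = jet a b H.
Proof. by move=> GH; apply: (eq_iter_dz oA) => //; apply: eq_iter_dzbar. Qed.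

Lemma jetD a b G H : CsmoothC A G -> CsmoothC A H ->
  jet a b (fun v => G v + H v) = jet a b G + jet a b H.
Proof.
move=> sG sH; rewrite /jet (eq_iter_dz oA _ (fun v => @iter_dzbarD _ _ oA b G H v sG sH) A0).
by rewrite (iter_dzD oA) //; exact: CsmoothC_iter_dzbar.
Qed.

Lemma jetZ a b c G : CsmoothC A G -> jet a b (fun v => c * G v) = c * jet a b G.
Proof.
move=> sG; rewrite /jet (eq_iter_dz oA _ (fun v => @iter_dzbarZ _ _ oA b c G v sG) A0).
by rewrite (iter_dzZ oA) //; exact: CsmoothC_iter_dzbar.
Qed.

Lemma jet0 a b : jet a b (fun=> 0) = 0.
Proof.
by have := jetZ a b 0 (scst 0); rewrite !mul0r.
Qed.

Lemma jet_sum a b (I : Type) (s : seq I) (F : I -> 'rV[R]_2 -> R[i]) :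
  (forall i, CsmoothC A (F i)) ->
  jet a b (fun v => \sum_(i <- s) F i v) = \sum_(i <- s) jet a b (F i).
Proof.
move=> sF; elim: s => [|i s IH].
  by rewrite big_nil -[RHS](jet0 a b); congr jet; apply/funext => v; rewrite big_nil.
rewrite big_cons -IH -jetD //; last exact: CsmoothC_sum.
by congr jet; apply/funext => v; rewrite big_cons.
Qed.

Lemma jet_dzbar a b G : jet a b (dzbar G) = jet a b.+1 G.
Proof. by rewrite /jet iterSr. Qed.

Lemma jet_dz a b G : CsmoothC A G -> jet a b (dz G) = jet a.+1 b G.
Proof.
move=> sG; rewrite /jet iterSr; apply: (eq_iter_dz oA) => // v Av.
exact: (iter_dzbar_dz oA _ sG Av).
Qed.

Lemma jetMz a b G : CsmoothC A G ->
  jet a b (fun v => toC v * G v) = a%:R * jet a.-1 b G.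
Proof.
move=> sG; rewrite /jet (eq_iter_dz oA _ (fun v => @iter_dzbarMz _ _ oA b G v sG) A0).
by rewrite (iter_dzMz oA _ (CsmoothC_iter_dzbar oA b sG) A0) toC0 mul0r addr0.
Qed.

Lemma jetMzbar a b G : CsmoothC A G ->
  jet a b (fun v => zbar v * G v) = b%:R * jet a b.-1 G.
Proof.
move=> sG; rewrite /jet (eq_iter_dz oA _ (fun v => @iter_dzbarMzbar _ _ oA b G v sG) A0).
have si k := CsmoothC_iter_dzbar oA k sG.
rewrite (iter_dzD oA _ (CsmoothCM oA (scst _) (si _)) (CsmoothCM oA szb (si _)) A0).
rewrite (iter_dzZ oA _ _ (si _) A0) (iter_dzMzbar oA _ (si _) A0) toC0 conjc0.
by rewrite mul0r addr0.
Qed.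

(** The falling factorial [a ^_ s] is 0 for [a < s], which makes the truncated difference [a - s]
    correct in all cases. *)
Lemma jetMzX s a b G : CsmoothC A G ->
  jet a b (fun v => toC v ^+ s * G v) = (a ^_ s)%:R * jet (a - s) b G.
Proof.
move=> sG; elim: s a => [|s IH] a.
  by rewrite ffactn0 mul1r subn0; congr jet; apply/funext => v; rewrite mul1r.
rewrite (_ : (fun v => _) = (fun v => toC v * (toC v ^+ s * G v))); last first.
  by apply/funext => v; rewrite exprS mulrA.
rewrite jetMz; last by apply: CsmoothCM => //; exact: CsmoothCX.
by rewrite IH mulrA -natrM -ffactnS; congr (_ * jet _ _ _); lia.
Qed.

Lemma jetMzbarX s a b G : CsmoothC A G ->
  jet a b (fun v => zbar v ^+ s * G v) = (b ^_ s)%:R * jet a (b - s) G.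
Proof.
move=> sG; elim: s b => [|s IH] b.
  by rewrite ffactn0 mul1r subn0; congr jet; apply/funext => v; rewrite mul1r.
rewrite (_ : (fun v => _) = (fun v => zbar v * (zbar v ^+ s * G v))); last first.
  by apply/funext => v; rewrite exprS mulrA.
rewrite jetMzbar; last by apply: CsmoothCM => //; exact: CsmoothCX.
by rewrite IH mulrA -natrM -ffactnS; congr (_ * jet _ _ _); lia.
Qed.

Lemma jet1 a b : jet a b (fun=> 1) = ((a == 0) && (b == 0))%:R.
Proof.
rewrite /jet; case: b => [|b].
  case: a => [|a]; first by [].
  rewrite iterSr (_ : dz _ = fun=> 0); first exact: (jet0 a 0).
  by apply/funext => v; exact: dz_cst.
rewrite iterSr (_ : dzbar _ = fun=> 0); first by rewrite andbF; exact: (jet0 a b).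
by apply/funext => v; exact: dzbar_cst.
Qed.

Lemma jet_monomial (a b i j : nat) :
  jet a b (fun v => toC v ^+ i * zbar v ^+ j) =
  (((a == i) && (b == j)) * (a`! * b`!))%:R.
Proof.
rewrite jetMzX; last exact: CsmoothCX.
rewrite (_ : (fun v => _ ^+ j) = (fun v => zbar v ^+ j * 1)); last first.
  by apply/funext => v; rewrite mulr1.
rewrite jetMzbarX // jet1 mulrA -!natrM; congr (_%:R).
have [ai|ai] := ltnP a i.
  by rewrite ffact_small // (ltn_eqF ai).
have [bj|bj] := ltnP b j.
  by rewrite (ffact_small bj) (ltn_eqF bj) andbF muln0.
rewrite !subn_eq0; have [->|ai'] := eqVneq a i; last by rewrite leqNgt ltn_neqAle eq_sym ai' ai /= muln0.
have [->|bj'] := eqVneq b j; last by rewrite [(b <= j)%N]leqNgt ltn_neqAle eq_sym bj' bj /= andbF muln0.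
by rewrite !leqnn !ffactnn mul1n muln1.
Qed.

(** Real partial derivatives are used instead of Wirtinger jets, since growth estimates and the
    derivatives of [zquot] are taken in real directions; [vanishing_jet] and [jet_vanishing]
    translate between the two. *)
Fixpoint vanishing M G : Prop :=
  if M is M'.+1 then G 0 = 0 /\ forall j, vanishing M' (pderivC j G) else True.

(** The partial derivatives are [dz + dzbar] and [i (dz - dzbar)], so their jets are combinations of
    jets of [G] one order higher. *)
Lemma vanishing_jet M G : CsmoothC A G ->
  (forall a b, (a + b < M)%N -> jet a b G = 0) -> vanishing M G.
Proof.
elim: M G => //= M IH G sG JG; split; first exact: (JG 0 0).
have sdz := CsmoothC_dz oA sG; have sdzb := CsmoothC_dzbar oA sG.
move=> j; apply: IH; first exact: CsmoothC_pderivC.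
move=> a b ab; have J1 : jet a b (dz G) = 0 by rewrite jet_dz // JG.
have J2 : jet a b (dzbar G) = 0 by rewrite jet_dzbar JG // addnS.
case: j => -[|[|//]] j2.
  rewrite (_ : pderivC _ G = fun v => dz G v + dzbar G v); last first.
    by apply/funext => v; rewrite -sum_dz_dzbar; congr pderivC; exact: val_inj.
  by rewrite jetD // J1 J2 addr0.
rewrite (_ : pderivC _ G = fun v => 'i%C * (dz G v + -1 * dzbar G v)); last first.
  by apply/funext => v; rewrite mulN1r -diff_dz_dzbar; congr pderivC; exact: val_inj.
have sm := CsmoothCM oA (scst (-1)) sdzb.
by rewrite jetZ; [rewrite (jetD a b sdz sm) (jetZ a b (-1) sdzb) J1 J2 mulr0 addr0 mulr0|exact: CsmoothCD].
Qed.

Lemma vanishing_pderivC M G j : vanishing M G -> vanishing M.-1 (pderivC j G).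
Proof. by case: M => //= M []. Qed.

Lemma eq_vanishing M G H : (forall v, A v -> G v = H v) -> vanishing M G -> vanishing M H.
Proof.
elim: M G H => //= M IH G H GH [G0 pG]; split=> [|j]; first by rewrite -GH.
by apply: IH (pG j) => v Av; apply: (eq_pderivC j oA).
Qed.

Lemma vanishingD M G H : CsmoothC A G -> CsmoothC A H ->
  vanishing M G -> vanishing M H -> vanishing M (fun v => G v + H v).
Proof.
elim: M G H => //= M IH G H sG sH [G0 pG] [H0 pH]; split=> [|j]; first by rewrite G0 H0 addr0.
have sGj := CsmoothC_pderivC j sG; have sHj := CsmoothC_pderivC j sH.
apply: eq_vanishing (IH _ _ sGj sHj (pG j) (pH j)) => v Av.
by rewrite (pderivCD j sG sH Av).
Qed.

(** By Leibniz' rule each derivative lowers the order of only one factor. *)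
Lemma vanishingM M a b G H : CsmoothC A G -> CsmoothC A H -> (M <= a + b)%N ->
  vanishing a G -> vanishing b H -> vanishing M (fun v => G v * H v).
Proof.
elim: M a b G H => //= M IH a b G H sG sH Mab vG vH; split=> [|j].
  case: a Mab vG => [|a] Mab; last by move=> [-> _]; rewrite mul0r.
  by case: b Mab vH => [|b] // _ [-> _]; rewrite mulr0.
have sGj := CsmoothC_pderivC j sG; have sHj := CsmoothC_pderivC j sH.
have vGj := vanishing_pderivC j vG; have vHj := vanishing_pderivC j vH.
apply: (@eq_vanishing _ (fun v => pderivC j G v * H v + G v * pderivC j H v)).
  by move=> v Av; rewrite (pderivCM j sG sH Av).
apply: vanishingD; [exact: CsmoothCM|exact: CsmoothCM| |].
  by apply: IH vGj vH => //; lia.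
by apply: IH vG vHj => //; lia.
Qed.

Lemma vanishingMl M G H : CsmoothC A G -> CsmoothC A H -> vanishing M H ->
  vanishing M (fun v => G v * H v).
Proof. by move=> sG sH vH; exact: (@vanishingM M 0 M). Qed.

Lemma vanishing0 M : vanishing M (fun=> 0).
Proof.
elim: M => //= M IH; split=> // j; apply: eq_vanishing IH => v _.
by rewrite pderivC_cst.
Qed.

Lemma vanishing_sum M (I : Type) (s : seq I) (F : I -> 'rV[R]_2 -> R[i]) :
  (forall i, CsmoothC A (F i)) -> (forall i, vanishing M (F i)) ->
  vanishing M (fun v => \sum_(i <- s) F i v).
Proof.
move=> sF vF; elim: s => [|i s IH].
  by apply: eq_vanishing (vanishing0 M) => v _; rewrite big_nil.
have sS := CsmoothC_sum s oA sF.
by apply: eq_vanishing (vanishingD (sF i) sS (vF i) IH) => v _; rewrite big_cons.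
Qed.

Lemma vanishing_conj M G : CsmoothC A G -> vanishing M G ->
  vanishing M (fun v => conjc (G v)).
Proof.
elim: M G => //= M IH G sG [G0 pG]; split=> [|j]; first by rewrite G0 conjc0.
have sGj := CsmoothC_pderivC j sG.
by apply: eq_vanishing (IH _ sGj (pG j)) => v Av; rewrite (pderivC_conj j sG Av).
Qed.

Lemma vanishing_dz M G : CsmoothC A G -> vanishing M.+1 G -> vanishing M (dz G).
Proof.
move=> sG [_ pG]; have s0 := CsmoothC_pderivC 0 sG; have s1 := CsmoothC_pderivC 1 sG.
have := vanishingMl (scst (- 'i%C)) s1 (pG 1).
move=> /(vanishingD s0 (CsmoothCM oA (scst _) s1) (pG 0)).
move=> /(vanishingMl (scst 2%:R^-1) (CsmoothCD oA s0 (CsmoothCM oA (scst _) s1))).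
by apply: eq_vanishing => v _; rewrite /dz mulNr.
Qed.

Lemma vanishing_dzbar M G : CsmoothC A G -> vanishing M.+1 G -> vanishing M (dzbar G).
Proof.
move=> sG [_ pG]; have s0 := CsmoothC_pderivC 0 sG; have s1 := CsmoothC_pderivC 1 sG.
have := vanishingMl (scst 'i%C) s1 (pG 1).
move=> /(vanishingD s0 (CsmoothCM oA (scst _) s1) (pG 0)).
exact: (vanishingMl (scst 2%:R^-1) (CsmoothCD oA s0 (CsmoothCM oA (scst _) s1))).
Qed.

Lemma jet_vanishing M G a b : CsmoothC A G -> vanishing M G -> (a + b < M)%N ->
  jet a b G = 0.
Proof.
elim: M G a b => // M IH G a b sG vG; case: b => [|b].
  case: a => [|a] aM; first by have [] := vG.
  rewrite -jet_dz //; apply: IH; [exact: CsmoothC_dz|exact: vanishing_dz|lia].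
move=> aM; rewrite -jet_dzbar; apply: IH; [exact: CsmoothC_dzbar|exact: vanishing_dzbar|lia].
Qed.

(* The quotient is read off the Taylor polynomial of degree less than q. *)
Lemma zbar_division s q G : CsmoothC A G ->
  (forall a b, (b < s)%N -> (a + b < q)%N -> jet a b G = 0) ->
  exists Q H, [/\ CsmoothC A Q, CsmoothC A H, vanishing q H
    & forall v, G v = zbar v ^+ s * Q v + H v].
Proof.
move=> sG JG.
(* The coefficient of [z^i zbar^(j+s)] in the Taylor expansion of [G], to be attached to
   [z^i zbar^j] in the quotient. *)
pose c (i j : nat) := jet i (j + s) G / (i`! * (j + s)`!)%:R.
pose m (i j : nat) v := c i j * (toC v ^+ i * zbar v ^+ j).
have smono (i j : nat) : CsmoothC A (fun v => toC v ^+ i * zbar v ^+ j).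
  by apply: CsmoothCM => //; exact: CsmoothCX.
have sm (i j : nat) : CsmoothC A (m i j) by exact: (CsmoothCM oA (scst _) (smono i j)).
have Jm (i j k l : nat) : jet k l (fun v => m i j v) = c i j * (((k == i) && (l == j)) * (k`! * l`!))%:R.
  by rewrite (jetZ k l (c i j) (smono i j)) jet_monomial.
pose Q v := \sum_(i < q) \sum_(j < q) m i j v.
have sQi i : CsmoothC A (fun v => \sum_(j < q) m i j v) by apply: CsmoothC_sum => // j; exact: sm.
have sQ : CsmoothC A Q by apply: CsmoothC_sum => // i; exact: sQi.
have sP : CsmoothC A (fun v => zbar v ^+ s * Q v) by apply: CsmoothCM => //; exact: CsmoothCX.
have sN := CsmoothCM oA (scst (-1)) sP.
exists Q, (fun v => G v + -1 * (zbar v ^+ s * Q v)); split=> //.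
- exact: CsmoothCD.
- apply: vanishing_jet; first exact: CsmoothCD.
  move=> a b ab; rewrite jetD // jetZ // jetMzbarX //.
  (* Jets with [b < s] vanish for [G] by hypothesis and for [zbar^s Q] by the falling factorial; the
     others agree by the choice of [c]. *)
  have [bs|bs] := ltnP b s; first by rewrite JG // ffact_small // mul0r mulr0 addr0.
  have aq : (a < q)%N by lia.
  have bq : (b - s < q)%N by lia.
  have JQ : jet a (b - s) Q = c a (b - s)%N * (a`! * (b - s)`!)%:R.
    rewrite /Q jet_sum; last by move=> i; exact: sQi.
    rewrite (bigD1 (Ordinal aq)) //= big1 ?addr0.
      rewrite jet_sum; last by move=> j; exact: sm.
      rewrite (bigD1 (Ordinal bq)) //= big1 ?addr0.
        by apply: etrans (Jm _ _ _ _) _; rewrite !eqxx mul1n.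
      move=> j /negPf jb; apply: etrans (Jm _ _ _ _) _.
      by rewrite [(_ - _)%N == _]eq_sym (jb : (nat_of_ord j == b - s)%N = false) andbF mul0n mulr0.
    move=> i /negPf ia; rewrite jet_sum; last by move=> j; exact: sm.
    apply: big1 => j _; apply: etrans (Jm _ _ _ _) _.
    by rewrite eq_sym (ia : (nat_of_ord i == a)%N = false) mul0n mulr0.
  have -> : (b ^_ s)%:R * jet a (b - s) Q = jet a b G.
    rewrite JQ /c subnK //; apply: mulr_divK.
      by rewrite pnatr_eq0 muln_eq0 negb_or -!lt0n !fact_gt0.
    by rewrite -natrM mulnCA ffact_fact.
  by rewrite mulN1r subrr.
- by move=> v; rewrite mulN1r addrC subrK.
Qed.

End Jets.

(** * Regularity of zbar^a / z^b h *)

Section SingularQuotients.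
Variables (R : realType) (A : set 'rV[R]_2).
Hypotheses (oA : open A) (A0 : A 0).
Implicit Types (G H h : 'rV[R]_2 -> R[i]) (j : 'I_2) (v : 'rV[R]_2).

(** * The modulus compared with the sup norm *)

Lemma cmod_ge0 (c : R[i]) : 0 <= cmod c.
Proof. by case: c => x y; exact: sqrtr_ge0. Qed.

Lemma normr_Re_le (c : R[i]) : `|complex.Re c| <= cmod c.
Proof.
case: c => x y; rewrite /cmod /= -sqrtr_sqr; apply: ler_wsqrtr.
by rewrite lerDl sqr_ge0.
Qed.

Lemma normr_Im_le (c : R[i]) : `|complex.Im c| <= cmod c.
Proof.
case: c => x y; rewrite /cmod /= -sqrtr_sqr; apply: ler_wsqrtr.
by rewrite lerDr sqr_ge0.
Qed.

Lemma cmod_le (c : R[i]) : cmod c <= `|complex.Re c| + `|complex.Im c|.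
Proof.
case: c => x y; rewrite /cmod /=.
rewrite -[leRHS]ger0_norm ?addr_ge0 // -sqrtr_sqr; apply: ler_wsqrtr.
by rewrite sqrrD !real_normK ?num_real // lerD2r lerDl mulrn_wge0 // mulr_ge0.
Qed.

Lemma cmod_toC_le v : cmod (toC v) <= 2 * `|v|.
Proof.
apply: le_trans (cmod_le _) _; rewrite /toC /= mulr_natl mulr2n.
by apply: lerD; exact: normr_coord.
Qed.

Lemma cmod_toC_ge v : `|v| <= cmod (toC v).
Proof.
rewrite [leLHS]/Num.Def.normr /= mx_normrE bigmax_le ?cmod_ge0 // => -[i j] _ /=.
rewrite ord1; case: j => -[|[|//]] j2.
  rewrite (_ : Ordinal j2 = 0); last exact: val_inj.
  exact: (normr_Re_le (toC v)).
rewrite (_ : Ordinal j2 = 1); last exact: val_inj.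
exact: (normr_Im_le (toC v)).
Qed.

Lemma toC_neq0 v : v != 0 -> toC v != 0.
Proof.
move=> v0; apply/eqP => t0; have := cmod_toC_ge v.
by rewrite t0 /cmod Normc.normc0 normr_le0 (negPf v0).
Qed.

(** The mean value inequality on the segment from 0 to [v] gains one factor [|v|] over the bound for
    the derivatives. The constant is doubled by the dimension 2, and once more by adding real and
    imaginary parts. *)
Lemma vanishing_bound M G : CsmoothC A G -> vanishing M G ->
  exists2 C, 0 <= C & exists2 r, 0 < r &
    forall v, `|v| < r -> A v /\ cmod (G v) <= C * `|v| ^+ M.
Proof.
elim: M G => [|M IH] G sG.
  move=> _; have [rG iG] := sG.
  have [C C0 [r r0 Cr]] := continuous_ball_bound (rG 0 0 A0).
  have [C' C'0 [r' r'0 Cr']] := continuous_ball_bound (iG 0 0 A0).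
  have /nbhs_ballP[rA /= rA0 Ab] := open_nbhs_nbhs (conj oA A0).
  exists (C + C'); first exact: addr_ge0.
  exists (Num.min rA (Num.min r r')); first by rewrite !lt_min rA0 r0.
  move=> v; rewrite !lt_min => /and3P[vA vr vr'].
  have bv (s : R) : `|v| < s -> ball 0 s v by rewrite -ball_normE /= sub0r normrN.
  split; first exact/Ab/bv.
  rewrite expr0 mulr1; apply: le_trans (cmod_le _) (lerD _ _).
    by apply/Cr/bv.
  by apply/Cr'/bv.
move=> [G0 pG].
have [C C0 [r r0 Cr]] := IH _ (CsmoothC_pderivC 0 sG) (pG 0).
have [C' C'0 [r' r'0 Cr']] := IH _ (CsmoothC_pderivC 1 sG) (pG 1).
have CC : 0 <= C + C' by exact: addr_ge0.
exists (2%:R * (C + C') + 2%:R * (C + C')); first by rewrite addr_ge0 // mulr_ge0.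
exists (Num.min r r'); first by rewrite !lt_min r0.
move=> v; rewrite lt_min => /andP[vr vr'].
split; first by have [] := Cr v vr.
have pb w j : `|w| <= `|v| -> A w /\ cmod (pderivC j G w) <= (C + C') * `|v| ^+ M.
  move=> wv; have vM : `|w| ^+ M <= `|v| ^+ M by rewrite lerXn2r ?nnegrE.
  have [Aw h0] := Cr w (le_lt_trans wv vr); have [_ h1] := Cr' w (le_lt_trans wv vr').
  split=> //; case: j => -[|[|//]] j2.
    rewrite (_ : Ordinal j2 = 0); last exact: val_inj.
    by apply: le_trans h0 _; apply: ler_pM; rewrite ?exprn_ge0 // lerDl.
  rewrite (_ : Ordinal j2 = 1); last exact: val_inj.
  by apply: le_trans h1 _; apply: ler_pM; rewrite ?exprn_ge0 // lerDr.
have tv (t : R) : 0 <= t <= 1 -> `|0 + t *: (v - 0)| <= `|v|.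
  move=> /andP[t0 t1]; rewrite add0r subr0 normrZ ger0_norm //.
  by rewrite -[leRHS]mul1r ler_wpM2r.
have main (f : 'rV[R]_2 -> R) : Csmooth A f -> f 0 = 0 ->
    (forall w j, `|pderiv j f w| <= cmod (pderivC j G w)) ->
    `|f v| <= 2%:R * (C + C') * `|v| ^+ M.+1.
  move=> sf f0 fG.
  have := @mean_value_le _ _ f 0 v ((C + C') * `|v| ^+ M).
  rewrite f0 !subr0 exprSr !mulrA; apply=> t.
    by move=> /tv /(pb _ 0)[At _]; rewrite subr0 in At; exact: (Ck_differentiable (sf 1%N)).
  move=> j /tv /(pb _ j)[_]; rewrite subr0; apply: le_trans; exact: fG.
have [rG iG] := sG.
rewrite mulrDl; apply: le_trans (cmod_le _) (lerD _ _).
  by apply: (main (fun w => complex.Re (G w))) => //; [rewrite G0|move=> w j; exact: (normr_Re_le (pderivC j G w))].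
by apply: (main (fun w => complex.Im (G w))) => //; [rewrite G0|move=> w j; exact: (normr_Im_le (pderivC j G w))].
Qed.

(* The value at 0 is 0 when b > 0. *)
Definition zquot (a b : nat) h v : R[i] := conjc (toC v) ^+ a * (toC v ^+ b)^-1 * h v.

Let A' := A `&` [set v | v != 0].

Let oA' : open A'.
Proof.
apply: openI => //; rewrite (_ : [set v | _] = ~` [set 0]).
  by apply: closed_openC; exact: (accessible_closed_set1 (hausdorff_accessible (@norm_hausdorff _ _))).
by apply/seteqP; split=> v /= /eqP.
Qed.

Lemma CsmoothC_subset (B B' : set 'rV[R]_2) G : B' `<=` B -> CsmoothC B G -> CsmoothC B' G.
Proof.
have sub k (f : 'rV[R]_2 -> R) : B' `<=` B -> Ck k B f -> Ck k B' f.
  move=> BB; elim: k f => [|k IH] f; first by move=> cf a /BB /cf.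
  by case=> df pf; split=> [a /BB /df //|i]; exact: IH (pf i).
by move=> BB [rG iG]; split=> k; [exact: (sub k _ BB (rG k))|exact: (sub k _ BB (iG k))].
Qed.

Let subA' : A' `<=` A. Proof. by move=> v []. Qed.

Let sz : CsmoothC A' (@toC R) := CsmoothC_toC oA'.
Let szb : CsmoothC A' (fun v => conjc (toC v)) := CsmoothC_conj oA' sz.

Let zn0 v b : A' v -> toC v ^+ b != 0.
Proof. by move=> [_ /= /toC_neq0]; exact: expf_neq0. Qed.

Let szV b : CsmoothC A' (fun v => (toC v ^+ b)^-1).
Proof. by apply: CsmoothCV => // [v /zn0|]; [apply|exact: CsmoothCX]. Qed.

Lemma CsmoothC_zquot a b h : CsmoothC A h -> CsmoothC A' (zquot a b h).
Proof.
move=> /(CsmoothC_subset subA') sh.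
exact: (CsmoothCM oA' (CsmoothCM oA' (CsmoothCX a oA' szb) (szV b)) sh).
Qed.

(** The derivative of [z] in direction [j]; that of [zbar] is its conjugate. *)
Let e j : R[i] := if j == 0 then 1 else 'i%C.

(** The derivative falls on [zbar^a], on [1 / z^b] or on [h]. If [h] vanishes to order [M], each
    case costs at most one unit of [a + M - b]; the truncated [a.-1] occurs for [a = 0] with
    coefficient 0 only. *)
Lemma pderivC_zquot a b h j v : CsmoothC A h -> A' v ->
  pderivC j (zquot a b h) v =
  zquot a.-1 b (fun w => a%:R * conjc (e j) * h w) v +
  zquot a b.+1 (fun w => - (b%:R * e j) * h w) v + zquot a b (pderivC j h) v.
Proof.
move=> /(CsmoothC_subset subA') sh Av.
have sX := CsmoothCX a oA' szb; have sY := szV b.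
rewrite (pderivCM j (CsmoothCM oA' sX sY) sh Av) (pderivCM j sX sY Av).
rewrite (pderivCX a j oA' szb Av) (pderivC_conj j sz Av).
rewrite (pderivCV j oA' (fun w => zn0 b (v := w)) (CsmoothCX b oA' sz) Av).
rewrite (pderivCX b j oA' sz Av) pderivC_toC -/(e j) /zquot.
have z0 : toC v != 0 by case: Av => _ /toC_neq0.
set z := toC v in z0 *; set zb := conjc z; set c := conjc (e j); set d := pderivC j h v.
have -> : - (b%:R * z ^+ b.-1 * e j / (z ^+ b) ^+ 2) = (z ^+ b.+1)^-1 * (- (b%:R * e j)).
  case: b sY => [|b] _; first by rewrite !mul0r oppr0 mulr0.
  rewrite /= !exprS; set p := z ^+ b.
  have p0 : p != 0 by exact: expf_neq0.
  by move: (b.+1%:R) => k; field; rewrite z0 p0.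
by move: (z ^+ b)^-1 (z ^+ b.+1)^-1 (zb ^+ a) (zb ^+ a.-1) => *; ring.
Qed.

(** For [a > 0] the numerator vanishes, for [b > 0] the convention [0^-1 = 0] applies, and for
    [a = b = 0] one has [M > 0], whence [h 0 = 0]. *)
Lemma zquot_at0 a b M h : (b < a + M)%N -> vanishing M h -> zquot a b h 0 = 0.
Proof.
move=> abM vh; rewrite /zquot toC0 conjc0.
case: a abM => [|a] abM; last by rewrite expr0n !mul0r.
case: b abM => [|b] abM; last by rewrite [_ ^+ b.+1]expr0n invr0 mulr0 mul0r.
by case: M vh abM => //= M [-> _]; rewrite mulr0.
Qed.

(** The quotient has size [|v|^(a + M - b)]. The factor [2^a] pays for replacing the modulus by the
    sup norm, and [|v| < 1] allows the smaller exponent [N]. *)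
Lemma zquot_bound a b M N h : (b + N <= a + M)%N -> CsmoothC A h -> vanishing M h ->
  exists2 C, 0 <= C & exists2 r, 0 < r &
    forall v, `|v| < r -> v != 0 -> A v /\ cmod (zquot a b h v) <= C * `|v| ^+ N.
Proof.
move=> abM sh vh; have [C C0 [r r0 Cr]] := vanishing_bound sh vh.
exists (2%:R ^+ a * C); first by rewrite mulr_ge0 // exprn_ge0.
exists (Num.min 1 r); first by rewrite lt_min ltr01.
move=> v; rewrite lt_min => /andP[v1 vr] v0; have [Av hv] := Cr v vr; split=> //.
have nv : 0 < `|v| by rewrite normr_gt0.
have nz : 0 < cmod (toC v) by apply: lt_le_trans nv (cmod_toC_ge v).
have cX n (c : R[i]) : cmod (c ^+ n) = cmod c ^+ n.
  by elim: n => [|n IH]; rewrite ?expr0 ?exprS /cmod ?Normc.normc1 // Normc.normcM -IH.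
have cJ (c : R[i]) : cmod (conjc c) = cmod c by case: c => x y; rewrite /cmod /= sqrrN.
have -> : cmod (zquot a b h v) = cmod (toC v) ^+ a * (cmod (toC v) ^+ b)^-1 * cmod (h v).
  by rewrite /zquot {1 2}/cmod !Normc.normcM Normc.normcV -/(cmod _) -/(cmod _) -/(cmod _) !cX cJ.
apply: (@le_trans _ _ ((2%:R * `|v|) ^+ a * (`|v| ^+ b)^-1 * (C * `|v| ^+ M))).
  apply: ler_pM; rewrite ?cmod_ge0 //; first by rewrite mulr_ge0 ?invr_ge0 ?exprn_ge0 ?cmod_ge0.
  apply: ler_pM; rewrite ?invr_ge0 ?exprn_ge0 ?cmod_ge0 //.
    by rewrite lerXn2r ?nnegrE ?cmod_ge0 ?mulr_ge0 // cmod_toC_le.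
  by rewrite lef_pV2 ?posrE ?exprn_gt0 // lerXn2r ?nnegrE ?cmod_ge0 // cmod_toC_ge.
have -> : (2%:R * `|v|) ^+ a * (`|v| ^+ b)^-1 * (C * `|v| ^+ M) =
    2%:R ^+ a * C * (`|v| ^+ (a + M) / `|v| ^+ b) by rewrite exprMn exprD; ring.
apply: ler_wpM2l; first by rewrite mulr_ge0 // exprn_ge0.
have -> : (a + M = (a + M - b - N) + N + b)%N by lia.
rewrite exprD mulfK ?expf_neq0 ?gt_eqF // exprD.
by rewrite ler_piMl ?exprn_ge0 // exprn_ile1 // ltW.
Qed.

Lemma zquot_pderiv_bound a b M N h : (b + N.+1 <= a + M)%N -> CsmoothC A h ->
  vanishing M h ->
  exists2 C, 0 <= C & exists2 r, 0 < r & forall v, `|v| < r -> v != 0 ->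
    forall j, cmod (pderivC j (zquot a b h) v) <= C * `|v| ^+ N.
Proof.
move=> abM sh vh.
suff bj j : exists2 C, 0 <= C & exists2 r, 0 < r & forall v, `|v| < r -> v != 0 ->
    cmod (pderivC j (zquot a b h) v) <= C * `|v| ^+ N.
  have [C C0 [r r0 Cr]] := bj 0; have [C' C'0 [r' r'0 Cr']] := bj 1.
  exists (C + C'); first exact: addr_ge0.
  exists (Num.min r r'); first by rewrite lt_min r0.
  move=> v; rewrite lt_min => /andP[vr vr'] v0 j.
  case: j => -[|[|//]] j2.
    rewrite (_ : Ordinal j2 = 0); last exact: val_inj.
    by apply: le_trans (Cr v vr v0) _; rewrite ler_wpM2r ?exprn_ge0 // lerDl.
  rewrite (_ : Ordinal j2 = 1); last exact: val_inj.
  by apply: le_trans (Cr' v vr' v0) _; rewrite ler_wpM2r ?exprn_ge0 // lerDr.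
have s1 := CsmoothCM oA (CsmoothC_cst (a%:R * conjc (e j)) oA) sh.
have s2 := CsmoothCM oA (CsmoothC_cst (- (b%:R * e j)) oA) sh.
have v1 := vanishingMl oA A0 (CsmoothC_cst (a%:R * conjc (e j)) oA) sh vh.
have v2 := vanishingMl oA A0 (CsmoothC_cst (- (b%:R * e j)) oA) sh vh.
have s3 := CsmoothC_pderivC j sh; have v3 := vanishing_pderivC j vh.
have h1 : (b + N <= a.-1 + M)%N by lia.
have [C1 C10 [r1 r10 H1]] := zquot_bound h1 s1 v1.
have h2 : (b.+1 + N <= a + M)%N by lia.
have [C2 C20 [r2 r20 H2]] := zquot_bound h2 s2 v2.
have h3 : (b + N <= a + M.-1)%N by lia.
have [C3 C30 [r3 r30 H3]] := zquot_bound h3 s3 v3.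
exists (C1 + C2 + C3); first by rewrite !addr_ge0.
exists (Num.min r1 (Num.min r2 r3)); first by rewrite !lt_min r10 r20.
move=> v; rewrite !lt_min => /and3P[vr1 vr2 vr3] v0.
have [Av b1] := H1 v vr1 v0; have [_ b2] := H2 v vr2 v0; have [_ b3] := H3 v vr3 v0.
rewrite (pderivC_zquot a b j sh (conj Av v0)) !mulrDl.
by apply: le_trans (le_normcD _ _) (lerD (le_trans (le_normcD _ _) (lerD b1 b2)) b3).
Qed.

Lemma zquot_differentiable0 (f : 'rV[R]_2 -> R) C r : 0 < r -> 0 <= C -> f 0 = 0 ->
  (forall v, `|v| < r -> v != 0 -> `|f v| <= C * `|v| ^+ 2) ->
  differentiable f 0 /\ forall j, pderiv j f 0 = 0.
Proof.
move=> r0 C0 f0 fC.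
have dc : continuous (\0 : {linear 'rV[R]_2 -> R}) by move=> v; exact: cst_continuous.
have [|df E] := @differentiable_intro _ _ _ f 0 _ dc; last first.
  by split=> // j; rewrite pderivE // E.
move=> eps eps0; apply/nbhs_ballP.
(* [C + 1] instead of [C] keeps the denominator positive when [C = 0]. *)
exists (Num.min r (eps / (C + 1))) => /=.
  by rewrite lt_min r0 divr_gt0 // ltr_wpDl.
move=> v; rewrite -ball_normE /= sub0r normrN lt_min => /andP[vr ve].
rewrite addr0 f0 !subr0.
have [->|v0] := eqVneq v 0; first by rewrite f0 !normr0 mulr0.
apply: le_trans (fC v vr v0) _; rewrite expr2 mulrA ler_wpM2r //.
rewrite ltr_pdivlMr ?ltr_wpDl // in ve.
by apply: le_trans (ltW ve); rewrite mulrC ler_wpM2l // lerDl.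
Qed.


(** Away from 0 the quotient is [C^1]; near 0 it has size [|v|] and bounded derivatives, the
    situation of [lipschitz_ball0]. The parameter [part] treats real and imaginary parts at once. *)
Lemma zquot_locally_lipschitz (part : R[i] -> R) a b M h :
  (part = @complex.Re R \/ part = @complex.Im R) ->
  (b < a + M)%N -> CsmoothC A h -> vanishing M h ->
  locally_lipschitz A (fun v => part (zquot a b h v)).
Proof.
move=> partE abM sh vh.
have part0 : part 0 = 0 by case: partE => ->.
have part_le c : `|part c| <= cmod c.
  by case: partE => ->; [exact: normr_Re_le|exact: normr_Im_le].
have [sR sI] := CsmoothC_zquot a b sh.
have sp k : Ck k A' (fun v => part (zquot a b h v)) by case: partE => ->; [exact: sR|exact: sI].
have pp j v : `|pderiv j (fun v => part (zquot a b h v)) v| <= cmod (pderivC j (zquot a b h) v).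
  by case: partE => ->; [exact: (normr_Re_le (pderivC j _ v))|exact: (normr_Im_le (pderivC j _ v))].
move=> v Av; have [->|v0] := eqVneq v 0; last first.
  by apply: (C1_locally_lipschitz oA' (sp 1%N)).
have [C C0 [r r0 HC]] : exists2 C, 0 <= C & exists2 r, 0 < r &
    forall v, `|v| < r -> v != 0 -> A v /\ cmod (zquot a b h v) <= C * `|v| ^+ 1.
  by apply: zquot_bound sh vh; rewrite addn1.
have [C' C'0 [r' r'0 HC']] : exists2 C, 0 <= C & exists2 r, 0 < r &
    forall v, `|v| < r -> v != 0 ->
    forall j, cmod (pderivC j (zquot a b h) v) <= C * `|v| ^+ 0.
  by apply: zquot_pderiv_bound sh vh; rewrite addn1.
have m0 : 0 < Num.min r r' by rewrite lt_min r0.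
exists (ball 0 (Num.min r r')); first exact: nbhsx_ballx.
apply: (@lipschitz_ball0 _ _ _ (C + C')) => //; first exact: addr_ge0.
  move=> w; rewrite -ball_normE /= sub0r normrN lt_min => /andP[wr wr'] w0.
  have [Aw _] := HC w wr w0; split=> [|j]; first exact: (Ck_differentiable (sp 1%N)).
  apply: le_trans (pp j w) (le_trans (HC' w wr' w0 j) _).
  by rewrite expr0 mulr1 lerDr.
move=> w; rewrite -ball_normE /= sub0r normrN lt_min => /andP[wr wr'].
have [->|w0] := eqVneq w 0.
  by rewrite (zquot_at0 abM vh) part0 !normr0 mulr0.
have [_ Hw] := HC w wr w0; apply: le_trans (part_le _) (le_trans Hw _).
by rewrite expr1 ler_wpM2r // lerDl.
Qed.

(** Induction on [N], the derivatives being sums of quotients of the same kind by [pderivC_zquot].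
    That formula covers only points other than 0; at 0 both sides are 0, the left one because the
    quotient has size [|v|^2], the right one by [zquot_at0]. *)
Lemma zquot_regular N a b M h :
  (b + N < a + M)%N -> CsmoothC A h -> vanishing M h ->
  Ck1loc N A (fun v => complex.Re (zquot a b h v)) /\
  Ck1loc N A (fun v => complex.Im (zquot a b h v)).
Proof.
elim: N a b M h => [|N IH] a b M h abM sh vh.
  rewrite addn0 in abM; split; first exact: (zquot_locally_lipschitz (or_introl erefl) abM sh vh).
  exact: (zquot_locally_lipschitz (or_intror erefl) abM sh vh).
have abM0 : (b < a + M)%N by lia.
have abM2 : (b + 2 <= a + M)%N by lia.
have z0 := zquot_at0 abM0 vh.
have [C C0 [r r0 HC]] := zquot_bound abM2 sh vh.
have [dR pR] : differentiable (fun v => complex.Re (zquot a b h v)) 0 /\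
    forall j, pderiv j (fun v => complex.Re (zquot a b h v)) 0 = 0.
  apply: (zquot_differentiable0 r0 C0); first by rewrite z0.
  by move=> v vr v0; have [_] := HC v vr v0; apply: le_trans; exact: normr_Re_le.
have [dI pI] : differentiable (fun v => complex.Im (zquot a b h v)) 0 /\
    forall j, pderiv j (fun v => complex.Im (zquot a b h v)) 0 = 0.
  apply: (zquot_differentiable0 r0 C0); first by rewrite z0.
  by move=> v vr v0; have [_] := HC v vr v0; apply: le_trans; exact: normr_Im_le.
have [sR sI] := CsmoothC_zquot a b sh.
have pz j : Ck1loc N A (fun v => complex.Re (pderivC j (zquot a b h) v)) /\
    Ck1loc N A (fun v => complex.Im (pderivC j (zquot a b h) v)).
  have s1 := CsmoothCM oA (CsmoothC_cst (a%:R * conjc (e j)) oA) sh.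
  have s2 := CsmoothCM oA (CsmoothC_cst (- (b%:R * e j)) oA) sh.
  have v1 := vanishingMl oA A0 (CsmoothC_cst (a%:R * conjc (e j)) oA) sh vh.
  have v2 := vanishingMl oA A0 (CsmoothC_cst (- (b%:R * e j)) oA) sh vh.
  have s3 := CsmoothC_pderivC j sh; have v3 := vanishing_pderivC j vh.
  have h1 : (b + N < a.-1 + M)%N by lia.
  have h2 : (b.+1 + N < a + M)%N by lia.
  have h3 : (b + N < a + M.-1)%N by lia.
  have [r1 i1] := IH _ _ _ _ h1 s1 v1; have [r2 i2] := IH _ _ _ _ h2 s2 v2.
  have [r3 i3] := IH _ _ _ _ h3 s3 v3.
  have E v : A v -> pderivC j (zquot a b h) v =
    zquot a.-1 b (fun w => a%:R * conjc (e j) * h w) v +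
    zquot a b.+1 (fun w => - (b%:R * e j) * h w) v + zquot a b (pderivC j h) v.
    move=> Av; have [->|v0] := eqVneq v 0; last by rewrite (pderivC_zquot a b j sh).
    rewrite (zquot_at0 _ v1) ?(zquot_at0 _ v2) ?(zquot_at0 _ v3) ?addr0; try by lia.
    by rewrite /pderivC pR pI.
  split.
    apply: eq_Ck1loc (Ck1locD oA (Ck1locD oA r1 r2) r3) => // v Av.
    by rewrite (E v Av) !raddfD.
  apply: eq_Ck1loc (Ck1locD oA (Ck1locD oA i1 i2) i3) => // v Av.
  by rewrite (E v Av) !raddfD.
split; split.
- move=> v Av; have [->|v0] := eqVneq v 0; first exact: dR.
  exact: (Ck_differentiable (sR 1%N)).
- by move=> j; have [] := pz j.
- move=> v Av; have [->|v0] := eqVneq v 0; first exact: dI.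
  exact: (Ck_differentiable (sI 1%N)).
- by move=> j; have [] := pz j.
Qed.

End SingularQuotients.

(** * Expansion at a branch point *)

Section BranchExpansion.
Variables (R : realType) (A : set 'rV[R]_2).
Hypotheses (oA : open A) (A0 : A 0).
Variable s : nat.
Implicit Types (G H : 'rV[R]_2 -> R[i]).

Let scst c : CsmoothC A (fun=> c) := CsmoothC_cst c oA.
Let sz : CsmoothC A (@toC R) := CsmoothC_toC oA.
Let szb : CsmoothC A (fun v => conjc (toC v)) := CsmoothC_conj oA sz.

Section OneComponent.
Variables (f : 'rV[R]_2 -> R) (D : 'rV[R]_2 -> R[i]).
Hypotheses (sf : Csmooth A f) (sD : CsmoothC A D).
Hypothesis dzf : forall v, A v ->
  dz (fun w => (f w)%:C) v = (s.+1%:R * toC v ^+ s) * D v.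

Let fC v : R[i] := (f v)%:C.
Let sfC : CsmoothC A fC := CsmoothC_real oA sf.

Lemma jet_dz_branch a b :
  jet a.+1 b fC = (s.+1 * a ^_ s)%:R * jet (a - s) b D.
Proof.
have sX := CsmoothCM oA (CsmoothCX s oA sz) sD.
rewrite -(jet_dz oA A0) // (eq_jet oA A0 a b (H := fun v => s.+1%:R * (toC v ^+ s * D v))).
  by rewrite (jetZ oA A0 _ _ _ sX) (jetMzX oA A0) // mulrA natrM.
by move=> v Av; rewrite dzf // mulrA.
Qed.

(** [f] is real, so conjugating the equation for [dz f] gives [dzbar f = (s+1) zbar^s conj(D)]. *)
Lemma jet_dzbar_branch a b :
  jet a b.+1 fC = (s.+1 * b ^_ s)%:R * jet a (b - s) (fun v => conjc (D v)).
Proof.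
have sDb := CsmoothC_conj oA sD; have sX := CsmoothCM oA (CsmoothCX s oA szb) sDb.
rewrite -jet_dzbar.
rewrite (eq_jet oA A0 a b (H := fun v => s.+1%:R * (conjc (toC v) ^+ s * conjc (D v)))).
  by rewrite (jetZ oA A0 _ _ _ sX) (jetMzbarX oA A0) // mulrA natrM.
move=> v Av; have <- : (fun w => conjc (fC w)) = fC.
  by apply/funext => w; exact: conjc_real.
by rewrite (dzbar_conj sfC) // dzf // !conjcM conjcX conjc_nat mulrA.
Qed.

(* f is real, so its mixed derivatives are divisible by both z^s and zbar^s. *)
Lemma jet_mixed_branch a b : (0 < b <= s)%N -> jet a b D = 0.
Proof.
case: b => // b /= bs.
(* One jet of [f] computed in two ways: through [dz] it is a nonzero multiple of [jet a b.+1 D],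
   through [dzbar] it carries the factor [b ^_ s], which is 0 as [b < s]. *)
have := jet_dz_branch (a + s) b.+1; rewrite jet_dzbar_branch addnK ffact_small //.
rewrite muln0 mul0r => /esym/eqP; rewrite mulf_eq0 pnatr_eq0 muln_eq0 /=.
by rewrite (gtn_eqF (_ : 0 < (a + s) ^_ s)%N) ?ffact_gt0 ?leq_addl // => /eqP.
Qed.

Lemma jet_pure_branch a : jet (a + s).+1 0 fC = 0 -> jet a 0 D = 0.
Proof.
rewrite jet_dz_branch addnK => /eqP; rewrite mulf_eq0 pnatr_eq0 muln_eq0 /=.
by rewrite (gtn_eqF (_ : 0 < (a + s) ^_ s)%N) ?ffact_gt0 ?leq_addl // => /eqP.
Qed.

(** [dz f] is divisible by [z^s] with a cofactor vanishing at 0. For the components [k >= 3] this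
    makes the index at least [s + 1]. *)
Lemma jet_low_branch j : D 0 = 0 -> (0 < j <= s.+1)%N -> jet j 0 fC = 0.
Proof.
move=> D0; case: j => // j /=; rewrite ltnS jet_dz_branch leq_eqVlt => /orP[/eqP->|js].
  by rewrite subnn /jet /= D0 mulr0.
by rewrite ffact_small // muln0 mul0r.
Qed.

(** Jets of [D] with [b = 0] vanish by assumption, those with [0 < b < s] because [f] is real. [Q]
    and [H] form a pair so that they can be chosen for all components at once. *)
Lemma branch_division q : (forall a, (a < q)%N -> jet (a + s).+1 0 fC = 0) ->
  exists QH : ('rV[R]_2 -> R[i]) * ('rV[R]_2 -> R[i]),
    [/\ CsmoothC A QH.1, CsmoothC A QH.2, vanishing q QH.2
      & forall v, D v = conjc (toC v) ^+ s * QH.1 v + QH.2 v].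
Proof.
move=> Jq; have [|Q [H [sQ sH vH E]]] := @zbar_division _ _ oA A0 s q D sD.
  move=> a [|b] bs ab; first by apply/jet_pure_branch/Jq; rewrite addn0 in ab.
  by apply: jet_mixed_branch; rewrite /= ltnW.
by exists (Q, H).
Qed.

End OneComponent.

(** [(zbar^s Q + H)^2 = zbar^s (zbar^s Q^2 + 2 Q H) + H^2]: the cross term joins the multiple of
    [zbar^s], and the order of the remainder doubles. *)
Lemma sum_sqr_division m q (D : 'I_m -> 'rV[R]_2 -> R[i]) :
  (forall i, exists QH : ('rV[R]_2 -> R[i]) * ('rV[R]_2 -> R[i]),
    [/\ CsmoothC A QH.1, CsmoothC A QH.2, vanishing q QH.2
      & forall v, D i v = conjc (toC v) ^+ s * QH.1 v + QH.2 v]) ->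
  exists Q H, [/\ CsmoothC A Q, CsmoothC A H, vanishing (2 * q) H
    & forall v, \sum_i D i v ^+ 2 = conjc (toC v) ^+ s * Q v + H v].
Proof.
move=> /choice[QH HQ].
have sX := CsmoothCX s oA szb.
pose Q i v := conjc (toC v) ^+ s * (QH i).1 v * (QH i).1 v + 2%:R * ((QH i).1 v * (QH i).2 v).
pose H i v := (QH i).2 v * (QH i).2 v.
have sQ i : CsmoothC A (Q i).
  have [s1 s2 _ _] := HQ i.
  exact: (CsmoothCD oA (CsmoothCM oA (CsmoothCM oA sX s1) s1) (CsmoothCM oA (scst _) (CsmoothCM oA s1 s2))).
have sH i : CsmoothC A (H i) by have [_ s2 _ _] := HQ i; exact: (CsmoothCM oA s2 s2).
have vH i : vanishing (2 * q) (H i).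
  have [_ s2 v2 _] := HQ i.
  by apply: (vanishingM oA A0 s2 s2 _ v2 v2); rewrite mul2n addnn.
exists (fun v => \sum_i Q i v), (fun v => \sum_i H i v); split.
- exact: CsmoothC_sum.
- exact: CsmoothC_sum.
- exact: (vanishing_sum oA A0 _ sH vH).
- move=> v; rewrite mulr_sumr -big_split /=; apply: eq_bigr => i _.
  by have [_ _ _ ->] := HQ i; rewrite /Q /H; ring.
Qed.

(** [(d0 - i d1)(d0 + i d1) = d0^2 + d1^2 = - S], and the second factor is invertible. *)
Lemma conformal_division q (d0 d1 S : 'rV[R]_2 -> R[i]) :
  CsmoothC A d0 -> CsmoothC A d1 ->
  (forall v, A v -> d0 v + 'i%C * d1 v != 0) ->
  (forall v, A v -> d0 v ^+ 2 + d1 v ^+ 2 + S v = 0) ->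
  (exists Q H, [/\ CsmoothC A Q, CsmoothC A H, vanishing q H
    & forall v, S v = conjc (toC v) ^+ s * Q v + H v]) ->
  exists X Y, [/\ CsmoothC A X, CsmoothC A Y, vanishing q Y
    & forall v, A v -> d0 v - 'i%C * d1 v = conjc (toC v) ^+ s * X v + Y v].
Proof.
move=> s0 s1 n0 E [Q [H [sQ sH vH SE]]].
have sDi := CsmoothCV oA n0 (CsmoothCD oA s0 (CsmoothCM oA (scst 'i%C) s1)).
have sm := CsmoothCN oA sDi.
exists (fun v => - (d0 v + 'i%C * d1 v)^-1 * Q v).
exists (fun v => - (d0 v + 'i%C * d1 v)^-1 * H v).
split; [exact: CsmoothCM|exact: CsmoothCM|exact: (vanishingMl oA A0 sm sH vH)|].
move=> v Av; apply: (mulIf (n0 v Av)).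
have -> : (d0 v - 'i%C * d1 v) * (d0 v + 'i%C * d1 v) = d0 v ^+ 2 - ('i%C * 'i%C) * d1 v ^+ 2 by ring.
rewrite mulcii mulN1r opprK.
have -> : d0 v ^+ 2 + d1 v ^+ 2 = - S v by apply/eqP; rewrite -addr_eq0 E.
rewrite SE; have := n0 v Av; move: (d0 v + _) => D D0.
by field.
Qed.

Lemma varpi_regular q (den E X Y w : 'rV[R]_2 -> R[i]) : (0 < s)%N -> (0 < q)%N ->
  CsmoothC A den -> CsmoothC A X -> CsmoothC A Y -> vanishing q Y ->
  (forall v, A v -> den v != 0) ->
  (forall v, A v -> E v = conjc (toC v) ^+ s * X v + Y v) ->
  w 0 = 0 ->
  (forall v, A v -> v != 0 ->
     w v = (conjc (toC v) ^+ s * conjc (E v)) / (toC v ^+ s * den v)) ->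
  Ck1loc q.-1 A (fun v => complex.Re (w v)) /\ Ck1loc q.-1 A (fun v => complex.Im (w v)).
Proof.
move=> s_gt0 q_gt0 sden sX sY vY den0 EXY w0 wE.
have sV := CsmoothCV oA den0 sden.
have sXb := CsmoothC_conj oA sX; have sYb := CsmoothC_conj oA sY.
have s1 := CsmoothCM oA (CsmoothCM oA (CsmoothCX s oA szb) sXb) sV.
have s2 := CsmoothCM oA sV sYb.
have v2 := vanishingMl oA A0 sV sYb (vanishing_conj oA A0 sY vY).
(* With [a = b = s], the order [q - 1] is the largest one that [zquot_regular] admits. *)
have h2 : (s + q.-1 < s + q)%N by lia.
have [r2 i2] := zquot_regular oA A0 h2 s2 v2.
have wE' v : A v -> conjc (toC v) ^+ s * conjc (X v) * (den v)^-1 +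
    zquot s s (fun v => (den v)^-1 * conjc (Y v)) v = w v.
  move=> Av; have [->|v0] := eqVneq v 0.
    (* At 0 both summands vanish through the factor [zbar^s], as [s > 0]. *)
    by rewrite w0 /zquot toC0 conjc0 expr0n (gtn_eqF s_gt0) !mul0r addr0.
  rewrite wE // EXY // conjcD conjcM conjcX conjcK /zquot.
  have z0 : toC v ^+ s != 0 by rewrite expf_neq0 // toC_neq0.
  have := den0 v Av; move: (den v) (toC v ^+ s) z0 (conjc (toC v) ^+ s) => D z z0 zb D0.
  by field; rewrite D0 z0.
split.
  apply: eq_Ck1loc (Ck1locD oA (Ck1_Ck1loc oA (s1.1 _)) r2) => // v Av.
  by rewrite -(wE' v Av) raddfD.
apply: eq_Ck1loc (Ck1locD oA (Ck1_Ck1loc oA (s1.2 _)) i2) => // v Av.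
by rewrite -(wE' v Av) raddfD.
Qed.

(** Pure z-jets do not see the term with [zbar^s], as [s > 0]. The factor [z^s] raises the order [q]
    of [Y] to [s + q], and passing from [dz c] to [c] adds one. *)
Lemma jet_distinguished q (c E X Y : 'rV[R]_2 -> R[i]) j : (0 < s)%N ->
  CsmoothC A c -> CsmoothC A X -> CsmoothC A Y -> vanishing q Y ->
  (forall v, A v -> dz c v = (s.+1%:R * toC v ^+ s) * E v) ->
  (forall v, A v -> E v = conjc (toC v) ^+ s * X v + Y v) ->
  (0 < j <= s + q)%N -> jet j 0 c = 0.
Proof.
move=> s_gt0 sc sX sY vY dzc EXY; case: j => // j /= jq.
have sbX := CsmoothCM oA (CsmoothCX s oA szb) sX.
have sE := CsmoothCD oA sbX sY.
have sX' := CsmoothCM oA (CsmoothCX s oA sz) sE.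
rewrite -(jet_dz oA A0) //.
rewrite (eq_jet oA A0 _ _
  (H := fun v => s.+1%:R * (toC v ^+ s * (conjc (toC v) ^+ s * X v + Y v)))); last first.
  by move=> v Av; rewrite dzc // EXY // mulrA.
rewrite (jetZ oA A0 _ _ _ sX') (jetMzX oA A0) // (jetD oA A0) // (jetMzbarX oA A0) //.
rewrite (ffact_small s_gt0) mul0r add0r.
have [js|js] := ltnP j s; first by rewrite ffact_small // mul0r mulr0.
by rewrite (jet_vanishing oA A0 sY vY) ?mulr0 //; lia.
Qed.

End BranchExpansion.

(** * Conformality in coordinates *)

Section Components.
Variable R : realType.

Lemma iter_dz_vec k j (G : 'rV[R]_2 -> 'rV[R[i]]_k) v i :
  iter j (@dz_vec R k) G v 0 i = iter j (@dz R) (fun w => G w 0 i) v.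
Proof.
elim: j v => // j IH v; rewrite !iterS {1}/dz_vec mxE.
rewrite (_ : (fun w => _) = iter j (@dz R) (fun w => G w 0 i)) //.
by apply/funext => w; exact: IH.
Qed.

Lemma jacobianE m n (h : 'rV[R]_m -> 'rV[R]_n) a i k : differentiable h a ->
  'J h a i k = pderiv i (fun v => h v 0 k) a.
Proof.
move=> dh; rewrite mxE -deriveE // derive_mx ?mxE //; exact: diff_derivable.
Qed.

(** The identity is assumed near [a] only, because a chart followed by its inverse is controlled on
    the image of the chart alone. *)
Lemma jacobian_id m (h : 'rV[R]_m -> 'rV[R]_m) a : (\near a, a = h a) ->
  'J h a = 1%:M.
Proof.
move=> ha; have dh : differentiable h a by exact: near_eq_differentiable ha _.
apply/matrixP => i k; rewrite jacobianE // mxE eq_sym -(pderiv_coord k i a).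
by rewrite /pderiv (near_eq_derive (f := fun v : 'rV[R]_m => v 0 k) (g := fun v => h v 0 k)) //;
  apply: filterS ha => v <-.
Qed.

Lemma cpt_ord (K : nmodType) n (v : 'rV[K]_n) (i : 'I_n) : cpt v i = v 0 i.
Proof. by rewrite /cpt valK. Qed.

Lemma sum_cpt (K : nmodType) n (F : nat -> K) : (2 <= n)%N ->
  \sum_(i < n) F i = F 0 + (F 1 + \sum_(i < n - 2) F i.+2).
Proof.
case: n => [|[|n]] // _; rewrite !big_ord_recl !subSS subn0.
by congr (_ + (_ + _)).
Qed.

Lemma Ck_cpt_nat n k (A : set 'rV[R]_2) (h : 'rV[R]_2 -> 'rV[R]_n) j : open A ->
  Ck k A h -> Ck k A (fun v => cpt (h v) j).
Proof.
move=> oA Ch; rewrite /cpt; case: insub => [i|]; first exact: Ck_cpt.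
exact: Ck_cst.
Qed.

(** For the vectors [a], [b] of partial derivatives, four times the sum is
    [|a|^2 - |b|^2 - 2 i <a, b>]: conformality means that the complex derivative is isotropic. *)
Lemma sum_sqr_wirtinger n (a b : 'I_n -> R) :
  \sum_k a k * a k = \sum_k b k * b k -> \sum_k a k * b k = 0 ->
  \sum_k (2%:R^-1 * ((a k)%:C - 'i%C * (b k)%:C)) ^+ 2 = 0.
Proof.
move=> aabb ab0.
have sq (u v c : R[i]) : (c * (u - 'i%C * v)) ^+ 2 =
    c ^+ 2 * (u * u + ('i%C * 'i%C) * (v * v)) - c ^+ 2 * 2%:R * 'i%C * (u * v) by ring.
under eq_bigr => k _ do rewrite sq mulcii mulN1r -!(rmorphM (real_complex R)) -(rmorphB (real_complex R)).
rewrite sumrB -!mulr_sumr -!(rmorph_sum (real_complex R)) ab0 sumrB aabb subrr.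
by rewrite rmorph0 !mulr0 subrr.
Qed.

Lemma sum_sqr_dz n (h : 'rV[R]_2 -> 'rV[R]_n) v :
  let D i k := pderiv i (fun w => h w 0 k) v in
  \sum_k D 0 k * D 0 k = \sum_k D 1 k * D 1 k -> \sum_k D 0 k * D 1 k = 0 ->
  \sum_k dz (fun w => (h w 0 k)%:C) v ^+ 2 = 0.
Proof.
move=> D E00 E01; rewrite -[RHS](sum_sqr_wirtinger E00 E01); apply: eq_bigr => k _.
by congr (_ ^+ 2); rewrite /dz /pderivC /= !(pderiv_cst 0).
Qed.

End Components.

Section ConformalCharts.
Variables (R : realType) (n : nat) (N : smooth_manifold R n) (g : riemannian_metric N).
Variables (M : riemann_surface R) (f : M -> N).
Variables (x : chart R M 2) (y : chart R N n).
Hypotheses (ax : atlas x) (ay : atlas y) (fxy : f @` cdom x `<=` cdom y).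

Lemma cimg_cap : x @` (cdom x `&` f @^-1` cdom y) = cimg x.
Proof.
rewrite /cimg; congr (x @` _); apply/seteqP; split=> q; first by case.
by move=> xq; split=> //; apply: fxy; exists q.
Qed.

(** Conformality of [y] is evaluated in the chart [y] itself, where the coordinate change is the
    identity. *)
Lemma metric_scalar : conformal_diffeomorphism g y ->
  forall q, cdom y q -> exists c : R, c != 0 /\ g y q = c *: 1%:M.
Proof.
move=> [rho yP] q yq; have [rho0 /(_ y ay yq)] := yP q yq.
have yid : \forall w \near y q, w = (y \o cinv y) w.
  have : nbhs (y q) (cimg y).
    by apply: open_nbhs_nbhs; split; [exact: cimg_open|exists q].
  by apply: filterS => _ [q' yq' <-] /=; rewrite cmapK.
rewrite /pullback_mx (jacobian_id yid) mul1mx trmx1 mulmx1 => E.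
exists (rho q)^-1; split; first by rewrite invr_eq0 gt_eqF.
by rewrite E scalerA mulVf ?scale1r // gt_eqF.
Qed.

(** The metric matrix is a nonzero multiple of the identity, so conformality of [f] makes the
    partial derivatives of its coordinate expression Euclidean orthogonal and of equal length. *)
Lemma conformal_dz : Cmap f 1 -> conformal f g -> conformal_diffeomorphism g y ->
  forall v, cimg x v -> \sum_k dz (fun w => (hat f x y w 0 k)%:C) v ^+ 2 = 0.
Proof.
move=> [_ /(_ x y ax ay)]; rewrite cimg_cap => -[dh _] cf cy v xv.
have [q xq qv] := xv.
have yfq : cdom y (f q) by apply: fxy; exists q.
have [c [c0 gc]] := metric_scalar cy yfq.
have := cf x y q ax ay xq yfq; rewrite qv gc /pullback_mx.
have JE i k : ('J (hat f x y) v *m (c *: 1%:M) *m ('J (hat f x y) v)^T) i k =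
    c * \sum_l pderiv i (fun w => hat f x y w 0 l) v * pderiv k (fun w => hat f x y w 0 l) v.
  rewrite -scalemxAr mulmx1 -scalemxAl mxE mxE; congr (_ * _).
  apply: eq_bigr => l _; rewrite [_^T l k]mxE !jacobianE //; exact: dh.
rewrite !JE => -[/(mulfI c0) E00 /eqP]; rewrite mulf_eq0 (negPf c0) /= => /eqP E01.
exact: sum_sqr_dz.
Qed.

End ConformalCharts.

(** * The theorem *)

Section BranchCoordinates.
Variables (R : realType) (n : nat) (n_ge3 : (3 <= n)%N).
Variables (N : smooth_manifold R n) (g : riemannian_metric N).
Variables (M : riemann_surface R) (f : M -> N).
Hypotheses (f_smooth : smooth_map f) (f_conformal : conformal f g).
Variables (p : M) (s : nat).
Hypothesis s_gt0 : (0 < s)%N.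
Variables (x : chart R M 2) (y : chart R N n).
Variables (d : 'rV[R]_2 -> 'rV[R[i]]_n) (d1' d2' : 'rV[R]_2 -> R[i]).
Hypothesis xy_branch : branch_coordinates f p s x y d d1' d2'.
Hypothesis y_conformal : conformal_diffeomorphism g y.

Let A := cimg x.
Let oA : open A := @cimg_open _ _ _ x.
Let F k v : R := cpt (hat f x y v) k.
Let D k v : R[i] := cpt (d v) k.

Let A0 : A 0.
Proof. by have [[_ _ xp _ _] <- _] := bc_charts xy_branch; exists p. Qed.

Let sF k : Csmooth A (F k).
Proof.
have [[ax ay _ _ fxy] _ _] := bc_charts xy_branch.
move=> l; apply: Ck_cpt_nat => //.
by have [_ /(_ x y ax ay)] := f_smooth l; rewrite cimg_cap.
Qed.

Let sD k : CsmoothC A (D k).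
Proof.
rewrite /D /cpt; case: insub => [i|]; first exact: (bc_smooth xy_branch).
exact: CsmoothC_cst.
Qed.

Let dzF k v : A v -> dz (fun w => (F k w)%:C) v = (s.+1%:R * toC v ^+ s) * D k v.
Proof.
move=> Av; rewrite /F /D /cpt; case: insub => [i|]; last by rewrite mulr0; exact: dz_cst.
have /(congr1 (fun u : 'rV[R[i]]_n => u 0 i)) := bc_dz xy_branch Av.
rewrite !mxE => <-; congr (dz _ v).
by apply/funext => w; rewrite mxE.
Qed.

Let sum_sqrD v : A v -> D 0 v ^+ 2 + D 1 v ^+ 2 + \sum_(i < n - 2) D i.+2 v ^+ 2 = 0.
Proof.
move=> Av; have [[ax ay _ _ fxy] _ _] := bc_charts xy_branch.
(* At 0 the factor [z^s] cannot be cancelled; there the normalisation of [d] gives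
   [1/4 - 1/4 = 0]. *)
have [v0|v0] := eqVneq v 0.
  rewrite big1 => [|i _]; last first.
    by rewrite v0 /D (bc_dk0 xy_branch) ?expr0n //=; have := ltn_ord i; rewrite ltn_subRL.
  rewrite /D (bc_d1 xy_branch Av) (bc_d2 xy_branch Av) v0 (bc_d1'0 xy_branch) (bc_d2'0 xy_branch).
  rewrite !addr0 !mulr1 sqrrN exprMn sqr_i mulN1r exprVn.
  by rewrite subrr.
rewrite -addrA -(@sum_cpt _ n (fun k => D k v ^+ 2)); last exact: ltnW.
have := conformal_dz ax ay fxy (f_smooth 1) f_conformal y_conformal Av.
rewrite (eq_bigr (fun k : 'I_n => (s.+1%:R * toC v ^+ s) ^+ 2 * D k v ^+ 2)).
  rewrite -mulr_sumr => /eqP; rewrite mulf_eq0 expf_eq0 /= mulf_eq0 expf_eq0 pnatr_eq0 /=.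
  by rewrite (negPf (toC_neq0 v0)) andbF => /eqP.
move=> k _; rewrite -exprMn -dzF //; congr (_ ^+ 2); congr (dz _ v).
by apply/funext => w; rewrite /F cpt_ord.
Qed.

(** This is the [D] of the overview; here [D] denotes the components of [d]. *)
Let den v : R[i] := D 0 v + 'i%C * D 1 v.
Let E v : R[i] := D 0 v - 'i%C * D 1 v.

Let denE v : A v -> den v = 1 + 2%:R^-1 * (d1' v + d2' v).
Proof.
move=> Av; rewrite /den /D (bc_d1 xy_branch Av) (bc_d2 xy_branch Av).
have -> : 'i%C * (- ('i%C / 2%:R) * (1 + d2' v)) = - ('i%C * 'i%C) * (2%:R^-1 * (1 + d2' v)) by ring.
rewrite mulcii opprK mul1r; field; rewrite ?pnatr_eq0 //.
Qed.

Let EE v : A v -> E v = 2%:R^-1 * (d1' v - d2' v).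
Proof.
move=> Av; rewrite /E /D (bc_d1 xy_branch Av) (bc_d2 xy_branch Av).
have -> : 'i%C * (- ('i%C / 2%:R) * (1 + d2' v)) = - ('i%C * 'i%C) * (2%:R^-1 * (1 + d2' v)) by ring.
rewrite mulcii opprK mul1r; ring.
Qed.

Let den0 v : A v -> den v != 0.
Proof. by move=> Av; rewrite denE //; exact: (bc_den xy_branch). Qed.

Let index_vector v : 'rV[R[i]]_(n - 2) := \row_(k < n - 2) (cpt (hat f x y v) k.+2)%:C.

Lemma iter_dz_index j i :
  iter j (@dz_vec R (n - 2)) index_vector 0 0 i = jet j 0 (fun v => (F i.+2 v)%:C).
Proof.
rewrite iter_dz_vec /jet /=; congr (iter j _ _ 0).
by apply/funext => w; rewrite mxE.
Qed.

Lemma branch_index_low j : (0 < j <= s.+1)%N ->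
  iter j (@dz_vec R (n - 2)) index_vector 0 = 0.
Proof.
move=> js; apply/rowP => i; rewrite iter_dz_index mxE.
apply: (jet_low_branch oA A0 (sF _) (sD i.+2) (@dzF i.+2)) js.
by rewrite /D (bc_dk0 xy_branch) //=; have := ltn_ord i; rewrite ltn_subRL.
Qed.

(** The hypothesis says that the index is at least [q + s]; leaving [q] free covers the infinite
    index. *)
Lemma branch_expansion q :
  (forall j, (0 < j <= q + s)%N -> iter j (@dz_vec R (n - 2)) index_vector 0 = 0) ->
  exists X Y, [/\ CsmoothC A X, CsmoothC A Y, vanishing (2 * q) Y
    & forall v, A v -> E v = conjc (toC v) ^+ s * X v + Y v].
Proof.
move=> iq; apply: (conformal_division oA A0 (sD 0) (sD 1) den0 sum_sqrD).
apply: (sum_sqr_division oA A0) => i.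
apply: (branch_division oA A0 (sF i.+2) (sD i.+2) (@dzF i.+2)) => a aq.
rewrite -iter_dz_index iq ?mxE //; lia.
Qed.

(** The components are real, so [conj(a) = f_1 - i f_2] and [dz conj(a) = (s+1) z^s E]. *)
Lemma distinguished_low q j :
  (forall j, (0 < j <= q + s)%N -> iter j (@dz_vec R (n - 2)) index_vector 0 = 0) ->
  (0 < j <= s + 2 * q)%N ->
  iter j (@dz_vec R 1) (fun v => \row_(k < 1) conjc (hatC f x y v)) 0 = 0.
Proof.
move=> /branch_expansion[X [Y [sX sY vY EXY]]] jq.
apply/rowP => i; rewrite iter_dz_vec mxE.
rewrite (_ : (fun w => _) = (fun w => (F 0 w)%:C + - 'i%C * (F 1 w)%:C)); last first.
  apply/funext => w; rewrite mxE /hatC /F; apply/eqP; rewrite eq_complex /=.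
  by apply/andP; split; apply/eqP; ring.
have sC k := CsmoothC_real oA (sF k).
have sm := CsmoothCM oA (CsmoothC_cst (- 'i%C) oA) (sC 1%N).
apply: (jet_distinguished oA A0 s_gt0 (CsmoothCD oA (sC 0%N) sm) sX sY vY _ EXY jq).
move=> v Av; rewrite (dzD (sC 0%N) sm Av) (dzZ oA _ (sC 1%N) Av) !dzF // /E.
by move: (D 0 v) (D 1 v) (toC v ^+ s) => d0 d1 z; ring.
Qed.

Lemma coefficient_regular q : (0 < q)%N ->
  (forall j, (0 < j <= q + s)%N -> iter j (@dz_vec R (n - 2)) index_vector 0 = 0) ->
  Ck1loc (2 * q).-1 A (fun v => complex.Re (distinguished_coefficient s d1' d2' v)) /\
  Ck1loc (2 * q).-1 A (fun v => complex.Im (distinguished_coefficient s d1' d2' v)).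
Proof.
move=> q_gt0 /branch_expansion[X [Y [sX sY vY EXY]]].
have sden : CsmoothC A den.
  exact: (CsmoothCD oA (sD 0) (CsmoothCM oA (CsmoothC_cst 'i%C oA) (sD 1))).
apply: (varpi_regular oA A0 s_gt0 _ sden sX sY vY den0 EXY).
- by rewrite muln_gt0.
- by rewrite /distinguished_coefficient eqxx.
- move=> v Av v0; rewrite /distinguished_coefficient (negPf v0) denE // EE //.
  by rewrite [conjc (2%:R^-1 * _)]conjcM conjc_inv conjc_nat.
Qed.

End BranchCoordinates.

Theorem proposition6p2 (R : realType) (n : nat) (n_ge3 : (3 <= n)%N)
  (N : smooth_manifold R n) (g : riemannian_metric N)
  (M : riemann_surface R) (f : M -> N)
  (f_smooth : smooth_map f) (f_branched : branched_immersion f)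
  (f_conformal : conformal f g)
  (p : M) (s : nat) (p_branch : is_branch_point f p s)
  (x : chart R M 2) (y : chart R N n)
  (d : 'rV[R]_2 -> 'rV[R[i]%C]_n) (d1' d2' : 'rV[R]_2 -> R[i]%C)
  (xy_branch : branch_coordinates f p s x y d d1' d2')
  (y_conformal : conformal_diffeomorphism g y)
  (iota rho : \bar int)
  (iotaE : iota = branch_index f x y)
  (rhoE : rho = distinguished_degree f s x y) :
  (2%:E * (iota - (s%:Z)%:E) <= rho)%E /\
  Ck1locC (2%:E * (iota - (s%:Z)%:E) - 1)%E (cimg x)
    (distinguished_coefficient s d1' d2').
Proof.
have s_gt0 : (0 < s)%N by case: p_branch.
have low := distinguished_low n_ge3 f_smooth f_conformal s_gt0 xy_branch y_conformal.
have reg := coefficient_regular n_ge3 f_smooth f_conformal s_gt0 xy_branch y_conformal.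
have idx0 := branch_index_low f_smooth xy_branch.
rewrite {}iotaE {}rhoE /branch_index /distinguished_degree /ord_z.
case: pselect => [h|nh].
  case: ex_minnP => j0 /andP[j0_gt0 j0n] j0min.
  (* [j0] is the index plus 1, so the index exceeds [s] and [q], the index minus [s], is
     positive. *)
  have j0s : (s.+1 < j0)%N.
    by rewrite ltnNge; apply: contra j0n => js; rewrite idx0 // j0_gt0.
  pose q := (j0 - s.+1)%N.
  have q_gt0 : (0 < q)%N by rewrite subn_gt0.
  have Hq j : (0 < j <= q + s)%N ->
      iter j (@dz_vec R (n - 2)) (fun v => \row_(k < n - 2) (cpt (hat f x y v) k.+2)%:C) 0 = 0.
    move=> /andP[j_gt0 jq]; apply/eqP; apply: contraTT (jq) => jn.
    have := j0min j; rewrite j_gt0 jn => /(_ isT); rewrite /q; lia.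
  have -> : (2%:E * ((j0%:Z)%:E - 1 - (s%:Z)%:E) = ((2 * q)%N%:Z)%:E)%E.
    rewrite -!EFinB -EFinM; congr EFin; rewrite /q; lia.
  have regq := reg q q_gt0 Hq.
  split; last first.
    (* [q > 0] makes [2 q - 1] a natural number, as the finite case of [Ck1locC] requires. *)
    rewrite -EFinB (_ : (2 * q)%N%:Z - 1 = ((2 * q).-1)%N%:Z); last by lia.
    exact: regq.
  case: pselect => [h'|_]; last exact: leey.
  case: ex_minnP => j1 /andP[j1_gt0 j1n] _.
  rewrite -EFinB lee_fin.
  (* [j1] is at least [s + 2 q + 1], and subtracting [s + 1] leaves at least [2 q]. *)
  have : (s + 2 * q < j1)%N.
    by rewrite ltnNge; apply: contra j1n => js; rewrite (low q) // j1_gt0.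
  lia.
(* For an infinite index the derivatives vanish as required for every [q]. *)
have Hq q j : (0 < j <= q + s)%N ->
    iter j (@dz_vec R (n - 2)) (fun v => \row_(k < n - 2) (cpt (hat f x y v) k.+2)%:C) 0 = 0.
  move=> /andP[j_gt0 _]; apply/eqP/negPn/negP => jn.
  by apply: nh; exists j; rewrite j_gt0.
have -> : (2%:E * (+oo - 1 - (s%:Z)%:E) = +oo :> \bar int)%E.
  by rewrite gt0_muley.
split; last first.
  have sm k : Ck k (cimg x) (fun v => complex.Re (distinguished_coefficient s d1' d2' v)) /\
      Ck k (cimg x) (fun v => complex.Im (distinguished_coefficient s d1' d2' v)).
    (* [q = k + 1] gives the class [C^{2k+1,1}], which is contained in [C^k]. *)
    have [rk ik] := reg k.+1 (ltn0Sn _) (@Hq k.+1).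
    have kk : (k <= (2 * k.+1).-1)%N by lia.
    by split; apply: Ck_le kk _; exact: Ck1loc_Ck.
  by split=> k; have [] := sm k.
case: pselect => [h'|_]; last exact: leey.
(* A finite order [j1] is impossible: the choice [q = j1] makes the derivative of order
   [j1 <= s + 2 j1] vanish. *)
case: ex_minnP => j1 /andP[j1_gt0 j1n] _.
by case/negP: j1n; rewrite (low j1 j1 (@Hq j1)) // j1_gt0 /=; lia.
Qed.
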